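(* Consider the Euler equations on a periodic domain, and on each element $\Omega_k\in\mathcal T_h$ the following two alternative semi-discretizations, with $\Omega_v$ denoting the neighbour of $\Omega_k$ across the facet $g$. (ES) The entropy-split discretization $$\frac{d\boldsymbol{u}_k}{dt}+\frac{\beta}{\beta+1}\sum_{i=1}^{d}\overline{\mathsf D}_{x_ik}\boldsymbol f_k^{I(i)}+\frac{1}{\beta+1}\sum_{i=1}^{d}\tilde{\mathsf A}_{i}\overline{\mathsf D}_{x_ik}\boldsymbol w_k=\overline{\mathsf H}_k^{-1}\sum_{i=1}^{d}\overline{\mathsf E}_{x_ik}\boldsymbol f_k^{I(i)}-\frac12\overline{\mathsf H}_k^{-1}\sum_{g\in\Gamma_k^I}\sum_{i=1}^{d}\left[\overline{\mathsf E}_{x_i}^{kv}\circ\mathsf F_i(\boldsymbol u_k,\boldsymbol u_v)\right]\boldsymbol 1 .$$ (HF) The Hadamard-form discretization based on the Sjögreen–Yee two-point flux $$\frac{d\boldsymbol{u}_k}{dt}+\sum_{i=1}^{d}\left[\overline{\mathsf D}_{x_ik}\circ\mathsf F_i(\boldsymbol u_k,\boldsymbol u_k)\right]\boldsymbol 1=\frac12\overline{\mathsf H}_k^{-1}\sum_{i=1}^{d}\left[\overline{\mathsf E}_{x_ik}\circ\mathsf F_i(\boldsymbol u_k,\boldsymbol u_k)\right]\boldsymbol 1-\frac12\overline{\mathsf H}_k^{-1}\sum_{g\in\Gamma_k^I}\sum_{i=1}^{d}\left[\overline{\mathsf E}_{x_i}^{kv}\circ\mathsf F_i(\boldsymbol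 u_k,\boldsymbol u_v)\right]\boldsymbol 1 .$$ (a) (HF) may be applied on a single element or on any group of elements, with (ES) on the remaining ones, without destroying entropy conservation: the resulting hybrid scheme satisfies $\sum_{\Omega_k\in\mathcal T_h}\boldsymbol 1^T\mathsf H_k\frac{d\boldsymbol s_k}{dt}=0$. (b) The scheme is locally conservative on the elements where (HF) is applied. (c) The discretization on a single element or group of elements may be switched between (HF) and (ES) at different timesteps without loss of entropy conservation of the resulting hybrid scheme: the identity in (a) holds at all times, whichever of the two forms is currently used on each element.
   Context: **Euler equations and Harten entropy.** Let $d\in\{1,2,3\}$, $\gamma=7/5$, $n_c=d+2$. Conservative variables: $\mathcal U=(\rho,\rho V_1,\dots,\rho V_d,e)^T$ with $\rho>0$, $p>0$, $e=p/(\gamma-1)+\tfrac12\rho V^TV$ (the symbol $p$ also denotes the polynomial degree of the operators). Inviscid fluxes: $\mathcal F^{I(i)}=(\rho V_i,\ \rho V_iV_1+\delta_{i1}p,\dots,\rho V_iV_d+\delta_{id}p,\ (e+p)V_i)^T$. Let $\alpha\in\mathbb R$ with $\alpha>0$ or $\alpha<-\gamma$ and $\beta=-(\gamma+\alpha)/(\gamma-1)$. Harten's entropy: $\mathcal S=\beta\rho(p\rho^{-\gamma})^{1/(\alpha+\gamma)}$; entropy variables $\mathcal W=(\partial\mathcal S/\partial\mathcal U)^T$, explicitly $\mathcal W^T=\frac{\rho}{p}(p\rho^{-\gamma})^{\frac1{\alpha+\gamma}}\left[-\frac{\alpha}{\gamma-1}\frac p\rho-\frac12V^TV,\ V^T,\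 -1\right]$. The map $\mathcal U\mapsto\mathcal W$ is bijective onto its image, and $\tilde{\mathsf A}_i=\partial\mathcal F^{I(i)}/\partial\mathcal W$, which is symmetric. **Mesh and SBP operators.** The periodic domain $\Omega$ is tessellated into conforming, non-overlapping elements $\mathcal T_h=\{\Omega_k\}$ with piecewise smooth boundaries, obtained from a reference element by a bijective, time-independent polynomial mapping of degree $p_{\rm geom}\le p+1$ in 2D and $p_{\rm geom}\le\lfloor p/2\rfloor+1$ in 3D. By periodicity every facet is interior, shared by exactly two elements; $\Gamma_k^I$ is the set of facets of $\Omega_k$. Element $\Omega_k$ has $n_p$ nodes. For each direction $i$, $\mathsf D_{x_ik}=\mathsf H_k^{-1}\mathsf Q_{x_ik}$ is a degree-$p$ SBP operator: (1) $\mathsf D_{x_ik}$ differentiates polynomials of total degree $\le p$ exactly at the nodes (in particular $\mathsf D_{x_ik}\boldsymbol 1=\boldsymbol 0$); (2) $\mathsf H_k$ is diagonal with positive entries; (3) $\mathsf Q_{x_ik}=\mathsf S_{x_ik}+\frac12\mathsf E_{x_ik}$ with $\mathsf S_{x_ik}$ skew-symmetric and $\mathsf E_{x_ik}$ diagonal, satisfying $\boldsymbol p^T\mathsf E_{x_ik}\boldsymbol q=\int_{\partial\Omega_k}\mathcal P\mathcal Q\,n_{x_i}\,d\Gamma$ for polynomials $\mathcal P,\mathcal Q$ of degree $\le r$, $r\ge p$. Facet nodes are a subset of the volume nodes: for a facet $g$ of $\Omega_k$, $\mathsf R_{gk}$ is the matrix selecting the volume-node values at the $n_f$ facet nodes (facet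 nodes of adjacent elements coincide and are ordered identically), $\mathsf B_g$ is the diagonal matrix of positive facet quadrature weights, $\mathsf N_{x_ig}$ the diagonal matrix of the $i$-th components of the unit normal on $g$ outward to $\Omega_k$, and $\mathsf E_{x_ik}=\sum_{g}\mathsf E_{x_i}^{kk}$ with $\mathsf E_{x_i}^{kk}=\mathsf R_{gk}^T\mathsf B_g\mathsf N_{x_ig}\mathsf R_{gk}$. If $\Omega_v$ shares $g$ with $\Omega_k$, then $\mathsf E_{x_i}^{kv}=\mathsf R_{gk}^T\mathsf B_g\mathsf N_{x_ig}\mathsf R_{gv}$, $\mathsf E_{x_i}^{vk}=-\mathsf R_{gv}^T\mathsf B_g\mathsf N_{x_ig}\mathsf R_{gk}$, $\mathsf E_{x_i}^{vv}=-\mathsf R_{gv}^T\mathsf B_g\mathsf N_{x_ig}\mathsf R_{gv}$. An overbar denotes $\otimes\,\mathsf I_{n_c}$, $\circ$ is the Hadamard product, $\boldsymbol 1$ the vector of ones. **Nodal quantities.** $\boldsymbol u_k$ stacks the nodal values $\boldsymbol u_{k,m}\in\mathbb R^{n_c}$ of the numerical solution; $\boldsymbol f_k^{I(i)}$, $\boldsymbol w_k$, $\boldsymbol s_k$ stack the values of $\mathcal F^{I(i)}$, $\mathcal W$, $\mathcal S$ at $\boldsymbol u_{k,m}$; in the discretization $\tilde{\mathsf A}_i$ is the block-diagonal matrix with $n_c\times n_c$ blocks $\tilde{\mathsf A}_i(\boldsymbol u_{k,m})$. **Two-point flux.** $\mathsf F_i(\boldsymbol u_k,\boldsymbol u_v)$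 is the block matrix with $(m,n)$ block $2\,\mathrm{diag}[\mathcal F_i^*(\boldsymbol u_{k,m},\boldsymbol u_{v,n})]$, where $\mathcal F_i^*$ is the Sjögreen–Yee two-point flux: with $\boldsymbol z=(\frac\rho p(p\rho^{-\gamma})^{1/(\alpha+\gamma)},V^T,p)^T$, $\{u\}=\frac12(u'+u'')$ and $\{u^{r-1}\}_e=\frac1r\frac{(u')^r-(u'')^r}{u'-u''}$ (extended by continuity), $[\mathcal F_i^*]_1=\frac{\{z_1z_{i+1}\}}{\{z_1^{-\gamma/\alpha}\}\{z_{n_c}^{(1-\gamma-\alpha)/\alpha}\}_e}$, $[\mathcal F_i^*]_j=[\mathcal F_i^*]_1\{z_j\}+\delta_{(i+1)j}\{z_{n_c}\}$ for $2\le j\le n_c-1$, $[\mathcal F_i^*]_{n_c}=[\mathcal F_i^*]_1\left(\frac{\gamma}{\gamma-1}\{z_{n_c}^{-(\gamma-1)/\alpha}\}\{z_1^{-(\gamma+\alpha)/\alpha}\}_e+\sum_{j=2}^{n_c-1}\{z_j\}^2-\frac12\{\sum_{j=2}^{n_c-1}z_j^2\}\right)$. It is consistent, $\mathcal F_i^*(\mathcal U,\mathcal U)=\mathcal F^{I(i)}(\mathcal U)$, symmetric, $\mathcal F_i^*(\mathcal U',\mathcal U'')=\mathcal F_i^*(\mathcal U'',\mathcal U')$, and satisfies Tadmor's condition $(\mathcal W''-\mathcal W')^T\mathcal F_i^*(\mathcal U',\mathcal U'')=(\psi^{(i)})''-(\psi^{(i)})'$ with $\psi^{(i)}=\mathcal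 W^T\mathcal F^{I(i)}-V_i\mathcal S$. **Local conservation** on $\Omega_k$ means elementwise conservation: with $\overline{\mathsf I}=\boldsymbol 1\otimes\mathsf I_{n_c}$, the rate of change $\overline{\mathsf I}^T\overline{\mathsf H}_k\,d\boldsymbol u_k/dt$ of the elementwise totals of the conservative variables equals the sum over the facets of $\Omega_k$ of the interface terms $-\frac12\sum_i\overline{\mathsf I}^T[\overline{\mathsf E}_{x_i}^{kv}\circ\mathsf F_i(\boldsymbol u_k,\boldsymbol u_v)]\boldsymbol 1$, and at each shared facet the interface terms of the two adjacent elements cancel. *)

(* Defs.v *)
(* Vectors of R^n are column matrices ['cV[R]_n].  Their library norm is the sup
   norm; Euclidean lengths are given by [enorm]. *)
From HB Require Import structures.
From mathcomp Require Import all_boot all_order all_algebra.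
From mathcomp Require Import all_classical all_reals all_analysis.
From mathcomp.real_closed Require Import mxtens.
(* Not imported: its notations clash with those of MathComp-Analysis. *)
From mathcomp.multinomials Require mpoly.

Set Implicit Arguments.
Unset Strict Implicit.
Unset Printing Implicit Defensive.
Import Order.TTheory GRing.Theory Num.Theory.
Import numFieldNormedType.Exports.

Local Open Scope classical_set_scope.
Local Open Scope ring_scope.

Section Calculus.
Context {R : realType}.

Definition partial n (i : 'I_n) (f : 'cV[R]_n -> R) (x : 'cV[R]_n) : R :=
  'D_(delta_mx i 0 : 'cV[R]_n) f x.

Definition grad n (f : 'cV[R]_n -> R) (x : 'cV[R]_n) : 'cV[R]_n :=
  \col_i partial i f x.

(* Column convention: row [i] is the gradient of the [i]-th component. *)
Definition jac m n (f : 'cV[R]_n -> 'cV[R]_m) (x : 'cV[R]_n) : 'M[R]_(m, n) :=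
  \matrix_(i, j) partial j (fun y => f y i 0) x.

Fixpoint continuously_diff (k n : nat) (U : set 'cV[R]_n) (f : 'cV[R]_n -> R)
    : Prop :=
  match k with
  | 0 => forall x, U x -> {for x, continuous f}
  | k'.+1 => (forall x, U x -> differentiable f x) /\
             (forall i, continuously_diff k' U (partial i f))
  end.

Definition smooth n (U : set 'cV[R]_n) (f : 'cV[R]_n -> R) : Prop :=
  forall k, continuously_diff k U f.

(* Derivative at [t] of a function of time relative to the interval [J]: the
   usual derivative at interior points, the one-sided one at end points. *)
Definition has_deriv_in (W : normedModType R) (J : interval R) (f : R -> W)
    (t : R) (l : W) : Prop :=
  h^-1 *: (f (t + h) - f t) @[h --> within [set h | t + h \in J] 0^'] --> l.

Definition dotv n (x y : 'cV[R]_n) : R := \sum_i x i 0 * y i 0.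

Definition enorm n (x : 'cV[R]_n) : R := Num.sqrt (dotv x x).

(* Volume of the unit ball of R^s, for s <= 2. *)
Definition ball_volume (s : nat) : R :=
  match s with 0 => 1 | 1 => 2 | _ => pi end.

(* [s]-dimensional Hausdorff measure of R^n, normalised to be the
   [s]-dimensional area ([s <= 2]).  [r j] bounds the diameter of [C j]; empty
   covering sets do not contribute, which matters when [s = 0]. *)
Definition hausdorff (s n : nat) (A : set 'cV[R]_n) : \bar R :=
  ereal_sup [set ereal_inf [set m : \bar R |
      exists (C : nat -> set 'cV[R]_n) (r : nat -> R),
        [/\ A `<=` \bigcup_j C j,
            forall j, 0 <= r j < delta,
            forall j x y, C j x -> C j y -> enorm (x - y) <= r j
          & m = \esum_(j in [set j | C j !=set0])
                  (ball_volume s * (r j / 2) ^+ s)%:E]]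
    | delta in [set delta : R | 0 < delta]].

Definition surface_integral n (A : set 'cV[R]_n) (f : 'cV[R]_n -> R) : \bar R :=
  @integral _ (g_sigma_algebraType (@open 'cV[R]_n)) R
    (@hausdorff n.-1 n) A (EFin \o f).

Definition polyval n (P : mpoly.mpoly n R) (x : 'cV[R]_n) : R :=
  mpoly.meval (fun i => x i 0) P.

Definition poly_deg_le n (q : nat) (P : mpoly.mpoly n R) : Prop :=
  all (fun m => (mpoly.mdeg m <= q)%N) (mpoly.msupp P).

(* [S] is a smooth piece of the boundary of [A] with outward unit normal [nu]:
   near each of its points, [S] lies on a regular level set [phi = 0], and
   [A = {phi <= 0}] near the points of the relative interior [S0] of [S].  On
   the rim of [S] the normal is the limit of the normals on [S0]. *)
Definition smooth_piece n (A S S0 : set 'cV[R]_n) (nu : 'cV[R]_n -> 'cV[R]_n)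
    : Prop :=
  forall x, S x -> exists (U : set 'cV[R]_n) (phi : 'cV[R]_n -> R),
    [/\ open U /\ U x, smooth U phi,
        forall y, U y -> grad phi y != 0,
        forall y, S y -> U y ->
          phi y = 0 /\ nu y = (enorm (grad phi y))^-1 *: grad phi y
      & forall y, S0 y -> U y -> \forall z \near y, A z <-> phi z <= 0].

End Calculus.

Section Mesh.
Context {R : realType} {d : nat}.

(* The periodic domain is R^d modulo the lattice of the periods; an element is
   represented by one of its lifts to R^d. *)
Record mesh := Mesh {
  period : 'I_d -> R;
  elem : finType;
  face : finType;
  ref_face : finType;
  ref_elem : set 'cV[R]_d;
  ref_facet : ref_face -> set 'cV[R]_d;
  geom_deg : nat;
  geom : elem -> 'I_d -> mpoly.mpoly d R;
  face_of : elem -> ref_face -> face;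
  normal : elem -> face -> 'cV[R]_d -> 'cV[R]_d;
  (* [shift k g] carries the facet [g] of [k] onto the same facet of the
     neighbour of [k] *)
  shift : elem -> face -> 'cV[int]_d
}.

Variable M : mesh.

Definition lattice (z : 'cV[int]_d) : 'cV[R]_d :=
  \col_i (period M i * (z i 0)%:~R).

Definition geom_map (k : elem M) (xi : 'cV[R]_d) : 'cV[R]_d :=
  \col_i polyval (geom k i) xi.

Definition element (k : elem M) : set 'cV[R]_d := geom_map k @` ref_elem M.

Definition faces (k : elem M) : {set face M} := [set face_of k j | j : ref_face M].

Definition facet (k : elem M) (g : face M) : set 'cV[R]_d :=
  \bigcup_(j in [set j | face_of k j = g]) (geom_map k @` ref_facet j).

Definition facet_interior (k : elem M) (g : face M) : set 'cV[R]_d :=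
  facet k g `\` \bigcup_(g' in [set g' | g' != g]) facet k g'.

Definition neighbour (k : elem M) (g : face M) : elem M :=
  odflt k [pick v | (v != k) && (g \in faces v)].

(* Integral over the boundary of the [k]-th element of [f] times the [i]-th
   component of the outward unit normal. *)
Definition boundary_integral (k : elem M) (i : 'I_d) (f : 'cV[R]_d -> R)
    : \bar R :=
  (\sum_(g in faces k)
     surface_integral (facet k g) (fun x => f x * normal k g x i 0)%R)%E.

Record mesh_axioms (p : nat) : Prop := MeshAxioms {
  period_gt0 : forall i, 0 < period M i;
  ref_compact : compact (ref_elem M);
  ref_nonempty : ref_elem M !=set0;
  ref_regular : ref_elem M = closure (interior (ref_elem M));
  ref_boundary :
    ref_elem M `\` interior (ref_elem M) = \bigcup_j ref_facet (m := M) j;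
  ref_facet_closed : forall j : ref_face M, closed (ref_facet j);
  ref_facet_interior : forall j : ref_face M,
    ref_facet j `<=`
    closure (ref_facet j `\` \bigcup_(j' in [set j' | j' != j]) ref_facet j');
  ref_facet_overlap : forall j j' : ref_face M, j != j' ->
    hausdorff d.-1 (ref_facet j `&` ref_facet j') = 0%E;
  geom_deg_le : forall (k : elem M) i, poly_deg_le (geom_deg M) (geom k i);
  geom_deg_2D : d = 2%N -> (geom_deg M <= p.+1)%N;
  geom_deg_3D : d = 3%N -> (geom_deg M <= (p./2).+1)%N;
  geom_inj : forall k : elem M, set_inj (ref_elem M) (geom_map k);
  tessellation_cover : forall x, exists (k : elem M) z, element k (x + lattice z);
  tessellation_disjoint : forall (k l : elem M) z x,
    interior (element k) x -> interior (element l) (x + lattice z) ->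
    k = l /\ z = 0;
  face_of_inj : forall k : elem M, injective (face_of k);
  face_shared : forall g : face M, #|[pred k | g \in faces k]| = 2%N;
  boundary_smooth : forall (k : elem M) g, g \in faces k ->
    smooth_piece (element k) (facet k g) (facet_interior k g) (normal k g);
  conforming : forall (k : elem M) g, g \in faces k ->
    facet (neighbour k g) g = (fun x => x + lattice (shift k g)) @` facet k g;
  normal_opposite : forall (k : elem M) g x, g \in faces k -> facet k g x ->
    normal (neighbour k g) g (x + lattice (shift k g)) = - normal k g x
}.

End Mesh.
Arguments mesh : clear implicits.

Section SBP.
Context {R : realType} {d : nat} (M : mesh R d) {np nf : nat}.

Record sbp := SBP {
  node : elem M -> 'I_np -> 'cV[R]_d;
  facet_node : elem M -> face M -> 'I_nf -> 'I_np;
  matH : elem M -> 'M[R]_np;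
  matB : face M -> 'M[R]_nf;
  matS : 'I_d -> elem M -> 'M[R]_np;
  sbp_deg : nat
}.

Variable B : sbp.

Definition matR (g : face M) (k : elem M) : 'M[R]_(nf, np) :=
  \matrix_(f, m) (m == facet_node B k g f)%:R.

Definition matN (i : 'I_d) (g : face M) (k : elem M) : 'M[R]_nf :=
  diag_mx (\row_f normal k g (node B k (facet_node B k g f)) i 0).

(* [coupling i g k v] uses the normal outward to [k].  For the two elements
   [k], [v] sharing [g], [matN i g v = - matN i g k]. *)
Definition coupling (i : 'I_d) (g : face M) (k v : elem M) : 'M[R]_np :=
  (matR g k)^T *m matB B g *m matN i g k *m matR g v.

Definition matE (i : 'I_d) (k : elem M) : 'M[R]_np :=
  \sum_(g in faces k) coupling i g k k.

Definition matQ (i : 'I_d) (k : elem M) : 'M[R]_np :=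
  matS B i k + 2^-1 *: matE i k.

Definition matD (i : 'I_d) (k : elem M) : 'M[R]_np :=
  invmx (matH B k) *m matQ i k.

Definition nodal_poly (k : elem M) (P : mpoly.mpoly d R) : 'cV[R]_np :=
  \col_m polyval P (node B k m).

Record sbp_axioms (p : nat) : Prop := SBPAxioms {
  node_in : forall k m, element k (node B k m);
  node_inj : forall k, injective (node B k);
  facet_node_inj : forall k g, g \in faces k -> injective (facet_node B k g);
  facet_node_in : forall k g f, g \in faces k ->
    facet k g (node B k (facet_node B k g f));
  facet_node_match : forall k g f, g \in faces k ->
    node B (neighbour k g) (facet_node B (neighbour k g) g f) =
    node B k (facet_node B k g f) + lattice M (shift k g);
  matH_diag : forall k, is_diag_mx (matH B k);
  matH_gt0 : forall k m, 0 < matH B k m m;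
  matB_diag : forall g, is_diag_mx (matB B g);
  matB_gt0 : forall g f, 0 < matB B g f f;
  matS_skew : forall i k, (matS B i k)^T = - matS B i k;
  matD_exact : forall i k P, poly_deg_le p P ->
    matD i k *m nodal_poly k P = nodal_poly k (mpoly.mderiv i P);
  sbp_deg_ge : (p <= sbp_deg B)%N;
  matE_exact : forall i k P Q,
    poly_deg_le (sbp_deg B) P -> poly_deg_le (sbp_deg B) Q ->
    (((nodal_poly k P)^T *m matE i k *m nodal_poly k Q) 0 0)%:E =
    boundary_integral k i (fun x => polyval P x * polyval Q x)
}.

End SBP.
Arguments sbp {R d} M np nf.

(* States of R^(d+2) are indexed by 'I_d.+2: first component, [d] middle
   components, last component. *)
Section Euler.
Context {R : realType} {d : nat}.

Definition mid (j : 'I_d) : 'I_d.+2 := lift ord0 (lift ord_max j).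

Definition stack3 (a : R) (b : 'cV[R]_d) (c : R) : 'cV[R]_d.+2 :=
  \col_j match unlift ord0 j with
         | None => a
         | Some j' => if unlift ord_max j' is Some l then b l 0 else c
         end.

Definition gam : R := 7 / 5.

Definition density (U : 'cV[R]_d.+2) : R := U ord0 0.
Definition velocity (U : 'cV[R]_d.+2) : 'cV[R]_d :=
  \col_j (U (mid j) 0 / density U).
Definition energy (U : 'cV[R]_d.+2) : R := U ord_max 0.
Definition pressure (U : 'cV[R]_d.+2) : R :=
  (gam - 1) *
  (energy U - 2^-1 * density U * dotv (velocity U) (velocity U)).

Definition admissible (U : 'cV[R]_d.+2) : Prop :=
  0 < density U /\ 0 < pressure U.

Definition euler_flux (i : 'I_d) (U : 'cV[R]_d.+2) : 'cV[R]_d.+2 :=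
  let V := velocity U in
  stack3 (density U * V i 0)
         (\col_j (density U * V i 0 * V j 0 + (i == j)%:R * pressure U))
         ((energy U + pressure U) * V i 0).

Variable alpha : R.

Definition harten_beta : R := - (gam + alpha) / (gam - 1).

Definition harten_power (U : 'cV[R]_d.+2) : R :=
  (pressure U * density U `^ (- gam)) `^ (alpha + gam)^-1.

Definition entropy (U : 'cV[R]_d.+2) : R :=
  harten_beta * density U * harten_power U.

Definition entropy_var (U : 'cV[R]_d.+2) : 'cV[R]_d.+2 := grad entropy U.

(* The inverse of [entropy_var] on the admissible states. *)
Definition cons_of_entropy_var (w : 'cV[R]_d.+2) : 'cV[R]_d.+2 :=
  xget 0 [set U | admissible U /\ entropy_var U = w].

(* The Jacobian of the flux, as a function of the entropy variables. *)
Definition flux_jac (i : 'I_d) (U : 'cV[R]_d.+2) : 'M[R]_d.+2 :=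
  jac (euler_flux i \o cons_of_entropy_var) (entropy_var U).

Definition mean (a b : R) : R := 2^-1 * (a + b).

(* The mean {u^s}_e of the function u^s, with s = r - 1. *)
Definition emean (s a b : R) : R :=
  if a == b then a `^ s else (s + 1)^-1 * ((a `^ (s + 1) - b `^ (s + 1)) / (a - b)).

Definition z_first (U : 'cV[R]_d.+2) : R :=
  density U / pressure U * harten_power U.

Definition sy_flux (i : 'I_d) (U' U'' : 'cV[R]_d.+2) : 'cV[R]_d.+2 :=
  let z1' := z_first U' in let z1'' := z_first U'' in
  let V' := velocity U' in let V'' := velocity U'' in
  let p' := pressure U' in let p'' := pressure U'' in
  let f1 :=
    mean (z1' * V' i 0) (z1'' * V'' i 0) /
    (mean (z1' `^ (- gam / alpha)) (z1'' `^ (- gam / alpha)) *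
     emean ((1 - gam - alpha) / alpha) p' p'') in
  stack3 f1
    (\col_j (f1 * mean (V' j 0) (V'' j 0) + (i == j)%:R * mean p' p''))
    (f1 * (gam / (gam - 1) *
             mean (p' `^ (- (gam - 1) / alpha)) (p'' `^ (- (gam - 1) / alpha)) *
             emean (- (gam + alpha) / alpha) z1' z1'' +
           \sum_j mean (V' j 0) (V'' j 0) ^+ 2 -
           2^-1 * mean (\sum_j V' j 0 ^+ 2) (\sum_j V'' j 0 ^+ 2))).

End Euler.

(* Vectors stacking the nodal states of an element: component [c] at node [m]
   has index [mxtens_index (m, c)], consistently with the Kronecker product. *)
Section Discretization.
Context {R : realType} {d : nat}.
Local Notation nc := d.+2.

Definition overbar m n (A : 'M[R]_(m, n)) : 'M[R]_(m * nc, n * nc) :=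
  A *t (1%:M : 'M[R]_nc).

Definition hadamard m n (A B : 'M[R]_(m, n)) : 'M[R]_(m, n) :=
  map2_mx *%R A B.

Definition ones n : 'cV[R]_n := const_mx 1.

Variable np : nat.

Definition nodal (u : 'cV[R]_(np * nc)) (m : 'I_np) : 'cV[R]_nc :=
  \col_c u (mxtens_index (m, c)) 0.

Definition stack (f : 'cV[R]_nc -> 'cV[R]_nc) (u : 'cV[R]_(np * nc))
    : 'cV[R]_(np * nc) :=
  \col_a let: (m, c) := mxtens_unindex a in f (nodal u m) c 0.

Definition block_diag (A : 'cV[R]_nc -> 'M[R]_nc) (u : 'cV[R]_(np * nc))
    : 'M[R]_(np * nc) :=
  \matrix_(a, b)
    let: (m, c) := mxtens_unindex a in let: (n, c') := mxtens_unindex b in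
    if m == n then A (nodal u m) c c' else 0.

Variable alpha : R.

Definition entropy_vec (u : 'cV[R]_(np * nc)) : 'cV[R]_np :=
  \col_m entropy alpha (nodal u m).

Definition flux_mx (i : 'I_d) (u v : 'cV[R]_(np * nc)) : 'M[R]_(np * nc) :=
  \matrix_(a, b)
    let: (m, c) := mxtens_unindex a in let: (n, c') := mxtens_unindex b in
    (2 *: diag_mx (sy_flux alpha i (nodal u m) (nodal v n))^T) c c'.

Context {nf : nat} (M : mesh R d) (B : sbp M np nf).
Implicit Types (u du : elem M -> 'cV[R]_(np * nc)) (k : elem M) (g : face M).

Definition interface_flux u k g (i : 'I_d) : 'cV[R]_(np * nc) :=
  let v := neighbour k g in
  hadamard (overbar (coupling B i g k v)) (flux_mx i (u k) (u v)) *m ones _.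

Definition scheme_ES u du k : Prop :=
  let beta := harten_beta alpha in
  let Hinv := invmx (overbar (matH B k)) in
  du k
  + (beta / (beta + 1)) *:
      (\sum_i overbar (matD B i k) *m stack (euler_flux i) (u k))
  + (beta + 1)^-1 *:
      (\sum_i block_diag (flux_jac alpha i) (u k) *m
                (overbar (matD B i k) *m stack (entropy_var alpha) (u k)))
  = Hinv *m (\sum_i overbar (matE B i k) *m stack (euler_flux i) (u k))
    - 2^-1 *: (Hinv *m \sum_(g in faces k) \sum_i interface_flux u k g i).

Definition scheme_HF u du k : Prop :=
  let Hinv := invmx (overbar (matH B k)) in
  du k
  + \sum_i hadamard (overbar (matD B i k)) (flux_mx i (u k) (u k)) *m ones _
  = 2^-1 *: (Hinv *m
      \sum_i hadamard (overbar (matE B i k)) (flux_mx i (u k) (u k)) *m ones _)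
    - 2^-1 *: (Hinv *m \sum_(g in faces k) \sum_i interface_flux u k g i).

(* On the time interval [J], [u] solves the scheme using (HF) on the elements
   of [HF] and (ES) on the others, with [du] its time derivative. *)
Definition hybrid_solution (HF : {set elem M}) (J : interval R)
    (u du : R -> elem M -> 'cV[R]_(np * nc)) : Prop :=
  forall t, t \in J -> forall k,
    [/\ forall m, admissible (nodal (u t k) m),
        has_deriv_in J (fun t => u t k) t (du t k)
      & if k \in HF then scheme_HF (u t) (du t) k
        else scheme_ES (u t) (du t) k].

Definition entropy_conservation (J : interval R)
    (u : R -> elem M -> 'cV[R]_(np * nc)) : Prop :=
  forall t, t \in J -> exists ds : elem M -> 'cV[R]_np,
    (forall k, has_deriv_in J (fun t => entropy_vec (u t k)) t (ds k)) /\
    \sum_k (ones np)^T *m matH B k *m ds k = 0.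

Definition sum_mx : 'M[R]_(np * nc, 1 * nc) := overbar (ones np).

Definition interface_term u k g : 'cV[R]_(1 * nc) :=
  - 2^-1 *: \sum_i sum_mx^T *m interface_flux u k g i.

Definition locally_conservative u du k : Prop :=
  sum_mx^T *m overbar (matH B k) *m du k =
    \sum_(g in faces k) interface_term u k g /\
  forall g, g \in faces k ->
    interface_term u k g + interface_term u (neighbour k g) g = 0.

End Discretization.

(* Main.v *)
Require Import Defs.
From HB Require Import structures.
From mathcomp Require Import all_boot all_order all_algebra.
From mathcomp Require Import all_classical all_reals all_analysis.
From mathcomp.real_closed Require Import mxtens.
From mathcomp.multinomials Require mpoly.
From mathcomp Require Import ring lra.
Set Implicit Arguments.
Unset Strict Implicit.
Unset Printing Implicit Defensive.
Import Order.TTheory GRing.Theory Num.Theory.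
Import numFieldNormedType.Exports.
Local Open Scope classical_set_scope.
Local Open Scope ring_scope.

(** Write psi_i = z_1 V_i p for the flux potential, W for the entropy variables
and F* for the two-point flux.  The rate of change of the total entropy is the
sum over elements and nodes of H_mm W_m . du_m/dt.  The point is that the two
schemes contribute the same amount on an element k, namely the sum over its
facets g, the directions i and the facet nodes of

  b n_i (psi_i(u_k) - W(u_k) . F*_i(u_k, u_v)),

b being the quadrature weight and n_i the component of the normal outward to k
([entropy_rate_HF], [entropy_rate_ES]).  This quantity only involves traces on
the facet, so it does not matter which scheme is used on which element.  Seen
from the neighbour v the normal changes sign while F* is symmetric, so the two
contributions to a facet add up to

  b n_i ((psi_i(u_k) - psi_i(u_v)) - (W(u_k) - W(u_v)) . F*_i(u_k, u_v)),

which is zero by Tadmor's condition ([sy_flux_tadmor]).  Hence the total is zero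
([hybrid_entropy_conservation]) at each time, whatever the choice of schemes.

For (HF) the volume term pairs the skew-symmetric matrix S with W_m . F*(m, n);
antisymmetrising and applying Tadmor's condition turns the latter into
psi_m - psi_n, and the row sums of S are - 1/2 times those of E because D
annihilates constants.  What is left is psi^T E 1, a sum over facet nodes.

For (ES) the volume terms are combined using W^T A_i = beta F_i^T
([flux_jac_entropy]): the Jacobian term becomes the transpose of the flux term,
and Q + Q^T is the symmetric part of E, which only sees diagonal entries.  The
factor W . F_i = (beta + 1) psi_i ([entropy_flux_contraction]) then restores
psi^T E 1.  The relation W^T A_i = beta F_i^T itself follows by differentiating
W . F_i(W) = (beta + 1) psi_i(W) with respect to W, given that F_i is the
gradient of psi_i in the entropy variables ([is_diff_ev_potential]).  It is
obtained from an explicit inverse of the map from states to entropy variables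
([cons_of_entropy_varE]), defined on an open set.

Local conservation of (HF) is the same computation with W replaced by constant
vectors: the volume term pairs the skew-symmetric S with the symmetric F*. *)

(** * Components of a state *)

Lemma subvE {R : realType} n (x y : 'cV[R]_n) j : (x - y) j 0 = x j 0 - y j 0.
Proof. by rewrite !mxE. Qed.

Section States.
Context {R : realType} {d : nat}.
Implicit Types (U w : 'cV[R]_d.+2) (a c : R) (b : 'cV[R]_d).

Lemma stack3_first a b c : stack3 a b c ord0 0 = a.
Proof. by rewrite mxE unlift_none. Qed.

Lemma stack3_mid a b c (l : 'I_d) : stack3 a b c (mid l) 0 = b l 0.
Proof. by rewrite mxE /mid !liftK. Qed.

Lemma ord_max_lift : ord_max = lift ord0 ord_max :> 'I_d.+2.
Proof. exact: val_inj. Qed.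

Lemma stack3_last a b c : stack3 a b c ord_max 0 = c.
Proof. by rewrite mxE ord_max_lift liftK unlift_none. Qed.

Definition stack3E := (stack3_first, stack3_mid, stack3_last).

Lemma state_index (Q : 'I_d.+2 -> Prop) :
  Q ord0 -> (forall l, Q (mid l)) -> Q ord_max -> forall j, Q j.
Proof.
move=> Q0 Qm Ql j; case: (unliftP ord0 j) => [j' ->|->//].
case: (unliftP ord_max j') => [l ->|->]; first exact: Qm.
by rewrite -ord_max_lift.
Qed.

Lemma sum_state (V : zmodType) (F : 'I_d.+2 -> V) :
  \sum_j F j = F ord0 + \sum_l F (mid l) + F ord_max.
Proof.
rewrite (bigD1_ord ord0)//= (bigD1_ord ord_max)//= -ord_max_lift.
by rewrite -addrA [in RHS](addrC (\sum_l _)).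
Qed.

Lemma dotv_stack3 a b c w :
  dotv (stack3 a b c) w =
    a * w ord0 0 + \sum_l b l 0 * w (mid l) 0 + c * w ord_max 0.
Proof.
by rewrite /dotv sum_state !stack3E; under eq_bigr do rewrite stack3E.
Qed.

End States.

(** * Entropy variables and the two-point flux *)

Section Thermo.
Context {R : realType} {d : nat}.
Variable alpha : R.
Hypothesis halpha : 0 < alpha \/ alpha < - gam.
Implicit Types (U w : 'cV[R]_d.+2).

Lemma gam_neq0 : gam != 0 :> R.
Proof. by rewrite gt_eqF// /gam; lra. Qed.

Lemma gam1_neq0 : gam - 1 != 0 :> R.
Proof. by rewrite gt_eqF// /gam; lra. Qed.

Lemma alpha_neq0 : alpha != 0.
Proof.
by move: halpha; rewrite /gam => -[h|h]; rewrite ?(gt_eqF h)// lt_eqF//; lra.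
Qed.

Lemma alpha_gam_neq0 : alpha + gam != 0.
Proof.
by move: halpha; rewrite /gam => -[h|h]; [rewrite gt_eqF//|rewrite lt_eqF//]; lra.
Qed.

(** [alpha_gam_neq0] for gamma = 7/5 with denominators cleared. *)
Lemma alpha_gam_num : alpha * 5 + 7 != 0.
Proof.
by move: halpha; rewrite /gam => -[h|h]; [rewrite gt_eqF//|rewrite lt_eqF//]; lra.
Qed.

Lemma beta1_neq0 : harten_beta alpha + 1 != 0.
Proof.
move: halpha; rewrite /harten_beta /gam.
have -> : - (7 / 5 + alpha) / (7 / 5 - 1) + 1 = - (5 / 2) * (alpha + 1) by field.
by move=> -[h|h]; [rewrite lt_eqF//|rewrite gt_eqF//]; lra.
Qed.

(** The entropy variables in closed form; [entropy_varE] identifies them with the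
gradient of the entropy on admissible states. *)
Definition entropy_vars U : 'cV[R]_d.+2 :=
  stack3 (z_first alpha U * (- (alpha / (gam - 1)) * (pressure U / density U)
            - 2^-1 * dotv (velocity U) (velocity U)))
         (z_first alpha U *: velocity U) (- z_first alpha U).

Lemma entropy_vars_first U : entropy_vars U ord0 0 =
  z_first alpha U * (- (alpha / (gam - 1)) * (pressure U / density U)
            - 2^-1 * dotv (velocity U) (velocity U)).
Proof. exact: stack3_first. Qed.

Lemma entropy_vars_mid U (l : 'I_d) :
  entropy_vars U (mid l) 0 = z_first alpha U * velocity U l 0.
Proof. by rewrite stack3_mid mxE. Qed.

Lemma entropy_vars_last U : entropy_vars U ord_max 0 = - z_first alpha U.
Proof. exact: stack3_last. Qed.

Definition entropy_varsE :=
  (entropy_vars_first, entropy_vars_mid, entropy_vars_last).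

(** The flux potential W . F_i - V_i S, which for Harten's entropy is the
product of the variables z entering the two-point flux. *)
Definition potential (i : 'I_d) U : R :=
  z_first alpha U * velocity U i 0 * pressure U.

Lemma harten_power_gt0 U : admissible U -> 0 < harten_power alpha U.
Proof. by move=> [r0 p0]; rewrite powR_gt0// mulr_gt0// powR_gt0. Qed.

Lemma z_first_gt0 U : admissible U -> 0 < z_first alpha U.
Proof.
move=> aU; have := harten_power_gt0 aU; case: aU => r0 p0 P0.
by rewrite mulr_gt0// divr_gt0.
Qed.

Lemma ln_z_first U : admissible U ->
  ln (z_first alpha U) = ln (density U) - ln (pressure U) +
    (alpha + gam)^-1 * (ln (pressure U) - gam * ln (density U)).
Proof.
move=> aU; have := harten_power_gt0 aU; case: aU => r0 p0 P0.
rewrite /z_first lnM ?posrE ?divr_gt0// ln_div ?posrE//.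
by rewrite ln_powR lnM ?posrE ?powR_gt0// ln_powR mulNr.
Qed.

(** Solving z_1 = (rho / p) P and P^(alpha + gamma) = p rho^(- gamma) for the
power P in terms of z_1 and p alone.  The exponents are those of the means in
the two-point flux: the jump of the first entropy variable splits into jumps of
powers of z_1 and of p, which the means [emean] express through the jumps of
z_1 and p. *)
Lemma harten_powerE U : admissible U ->
  z_first alpha U * (pressure U / density U) =
  z_first alpha U `^ (- gam / alpha) * pressure U `^ (- (gam - 1) / alpha).
Proof.
move=> aU; have z0 := z_first_gt0 aU; case: (aU) => r0 p0.
have th0 : 0 < pressure U / density U by exact: divr_gt0.
apply: ln_inj; rewrite ?posrE.
- exact: mulr_gt0.
- by apply: mulr_gt0; exact: powR_gt0.
rewrite (lnM z0 th0) (ln_div p0 r0) lnM ?posrE ?powR_gt0// !ln_powR.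
by rewrite ln_z_first// /gam; field; rewrite alpha_neq0 alpha_gam_num.
Qed.

Lemma mean_gt0 (a b : R) : 0 < a -> 0 < b -> 0 < mean a b.
Proof. by rewrite /mean => a0 b0; rewrite mulr_gt0 ?addr_gt0 ?invr_gt0. Qed.

(** Clearing denominators in the definition of [emean] gives an identity that
also covers equal arguments, where both sides vanish. *)
Lemma emean_jump (s a b : R) : s + 1 != 0 ->
  (s + 1) * emean s a b * (b - a) = b `^ (s + 1) - a `^ (s + 1).
Proof.
rewrite /emean => s0; case: eqVneq => [->|ab]; first by rewrite !subrr mulr0.
by field; rewrite s0 subr_eq0 ab.
Qed.

Lemma emean_neq0 (s a b : R) : s + 1 != 0 -> 0 < a -> 0 < b ->
  emean s a b != 0.
Proof.
move=> s0 a0 b0; rewrite /emean; case: (eqVneq a b) => [_|ab].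
  by rewrite gt_eqF// powR_gt0.
rewrite !mulf_neq0 ?invr_eq0 ?subr_eq0//; apply: contra_neq ab => /(congr1 (@ln R)).
rewrite !ln_powR => /(mulfI s0); exact: ln_inj.
Qed.

Lemma emeanC (s a b : R) : emean s a b = emean s b a.
Proof.
rewrite /emean eq_sym; case: eqVneq => [->//|ba].
by rewrite -(opprB a b) -(opprB (a `^ _)) invrN mulrNN.
Qed.

Lemma meanC (a b : R) : mean a b = mean b a.
Proof. by rewrite /mean addrC. Qed.

Definition sy_mass (i : 'I_d) U U' : R :=
  mean (z_first alpha U * velocity U i 0) (z_first alpha U' * velocity U' i 0) /
  (mean (z_first alpha U `^ (- gam / alpha)) (z_first alpha U' `^ (- gam / alpha)) *
   emean ((1 - gam - alpha) / alpha) (pressure U) (pressure U')).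

(** A two-point mean of the specific total enthalpy. *)
Definition sy_enthalpy U U' : R :=
  gam / (gam - 1) *
    mean (pressure U `^ (- (gam - 1) / alpha)) (pressure U' `^ (- (gam - 1) / alpha)) *
    emean (- (gam + alpha) / alpha) (z_first alpha U) (z_first alpha U') +
  \sum_j mean (velocity U j 0) (velocity U' j 0) ^+ 2 -
  2^-1 * mean (\sum_j velocity U j 0 ^+ 2) (\sum_j velocity U' j 0 ^+ 2).

Lemma sy_flux_first i U U' : sy_flux alpha i U U' ord0 0 = sy_mass i U U'.
Proof. exact: stack3_first. Qed.

Lemma sy_flux_mid i U U' (l : 'I_d) : sy_flux alpha i U U' (mid l) 0 =
  sy_mass i U U' * mean (velocity U l 0) (velocity U' l 0)
  + (i == l)%:R * mean (pressure U) (pressure U').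
Proof. by rewrite stack3_mid mxE. Qed.

Lemma sy_flux_last i U U' :
  sy_flux alpha i U U' ord_max 0 = sy_mass i U U' * sy_enthalpy U U'.
Proof. exact: stack3_last. Qed.

Lemma sy_massC i U U' : sy_mass i U U' = sy_mass i U' U.
Proof.
exact: (congr2 (fun a b => a / b) (meanC _ _)
          (congr2 *%R (meanC _ _) (emeanC _ _ _))).
Qed.

Lemma sy_enthalpyC U U' : sy_enthalpy U U' = sy_enthalpy U' U.
Proof.
have sumC : \sum_j mean (velocity U j 0) (velocity U' j 0) ^+ 2 =
            \sum_j mean (velocity U' j 0) (velocity U j 0) ^+ 2.
  by apply: eq_bigr => j _; rewrite meanC.
rewrite /sy_enthalpy sumC.
exact: (congr2 (fun a b => a + _ - 2^-1 * b)
  (congr2 (fun a b => _ * a * b) (meanC _ _) (emeanC _ _ _)) (meanC _ _)).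
Qed.

Lemma sy_fluxC i U U' : sy_flux alpha i U U' = sy_flux alpha i U' U.
Proof.
apply/colP; apply: state_index => [|l|].
- by rewrite !sy_flux_first sy_massC.
- rewrite !sy_flux_mid sy_massC.
  exact: (congr2 (fun a b => _ * a + _ * b) (meanC _ _) (meanC _ _)).
- by rewrite !sy_flux_last sy_massC sy_enthalpyC.
Qed.

(** The product rule for jumps, with a and b the two values of z_1 and x and y
those of V.  In Tadmor's condition the first term cancels the kinetic part of the
jump of the first entropy variable, and the second one, proportional to the jump
of z_1, is balanced by the energy component of the flux. *)
Lemma sum_mean_jump (a b : R) (x y : 'cV[R]_d) :
  \sum_j (a * x j 0 - b * y j 0) * mean (x j 0) (y j 0) =
  2^-1 * (a * \sum_j x j 0 ^+ 2 - b * \sum_j y j 0 ^+ 2) +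
  (a - b) * (\sum_j mean (x j 0) (y j 0) ^+ 2
     - 2^-1 * mean (\sum_j x j 0 ^+ 2) (\sum_j y j 0 ^+ 2)).
Proof.
rewrite /mean -big_split/= !mulr_sumr -sumrB !mulr_sumr -sumrB.
rewrite mulr_sumr -big_split /=; by apply: eq_bigr => j _; field.
Qed.

Lemma dotvv (x : 'cV[R]_d) : \sum_j x j 0 ^+ 2 = dotv x x.
Proof. by apply: eq_bigr => j _; rewrite expr2. Qed.

Lemma sum_delta (i : 'I_d) (m : R) (F : 'I_d -> R) :
  \sum_j (i == j)%:R * m * F j = m * F i.
Proof.
rewrite (bigD1 i)//= eqxx mul1r big1 ?addr0// => j.
by rewrite eq_sym => /negPf ->; rewrite !mul0r.
Qed.

(** Tadmor's condition once all powers and sums are replaced by variables.  Here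
X and Y are the powers of z and of the pressure q whose product is the Harten
power z t, with t = q / rho; the hypotheses on the jumps of X and Y come from
[emean_jump] and the last one is the definition of the mass flux f. *)
Lemma sy_flux_tadmor_scalar (a g f ep ez q q' v v' z z' t t' X X' Y Y' D D' K : R) :
  a != 0 -> g - 1 != 0 ->
  z * t = X * Y -> z' * t' = X' * Y' ->
  - g / a * ez * (z' - z) = X' - X ->
  - (g - 1) / a * ep * (q' - q) = Y' - Y ->
  f * (mean X X' * ep) = mean (z * v) (z' * v') ->
  f * (z * (- (a / (g - 1)) * t - 2^-1 * D)
       - z' * (- (a / (g - 1)) * t' - 2^-1 * D'))
  + (f * (2^-1 * (z * D - z' * D') + (z - z') * (K - 2^-1 * mean D D'))
     + mean q q' * (z * v - z' * v'))
  + f * (g / (g - 1) * mean Y Y' * ez + K - 2^-1 * mean D D') * (- z - - z')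
  = z * v * q - z' * v' * q'.
Proof.
rewrite /mean => a0 g1 hP hP' jz jp hf; apply/eqP; rewrite -subr_eq0; apply/eqP.
pose c := a / (g - 1).
(* the coefficients of the linear combination of the hypotheses: the jump of
   X Y is split by the product rule for jumps, which accounts for the means of
   Y and X multiplying the jump identities *)
transitivity (
  - c * f * ((z * t - X * Y) - (z' * t' - X' * Y'))
  - c * f * (2^-1 * (Y + Y')) * (- g / a * ez * (z' - z) - (X' - X))
  - c * f * (2^-1 * (X + X')) * (- (g - 1) / a * ep * (q' - q) - (Y' - Y))
  + (q - q') * (f * (2^-1 * (X + X') * ep) - 2^-1 * (z * v + z' * v'))).
  by rewrite /c; field; rewrite a0 g1.
by rewrite hP hP' jp jz hf !subrr !(mulr0, subr0, addr0).
Qed.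

(** The means in the flux are chosen so that F* contracted with the jump of W,
once expanded by the product rule for jumps, collapses to the expansion of the
jump of z_1 V_i p. *)
Lemma sy_flux_tadmor i U U' : admissible U -> admissible U' ->
  dotv (sy_flux alpha i U U') (entropy_vars U - entropy_vars U') =
  potential i U - potential i U'.
Proof.
move=> aU aU'.
have z0 := z_first_gt0 aU; have z0' := z_first_gt0 aU'.
have hP := harten_powerE aU; have hP' := harten_powerE aU'.
have a0 := alpha_neq0.
have hs1 : (1 - gam - alpha) / alpha + 1 = - (gam - 1) / alpha :> R by field.
have hs2 : - (gam + alpha) / alpha + 1 = - gam / alpha :> R by field.
have s1 : (1 - gam - alpha) / alpha + 1 != 0 :> R.
  by rewrite hs1; apply: mulf_neq0; rewrite ?invr_eq0 ?oppr_eq0// gam1_neq0.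
have s2 : - (gam + alpha) / alpha + 1 != 0 :> R.
  by rewrite hs2; apply: mulf_neq0; rewrite ?invr_eq0 ?oppr_eq0// gam_neq0.
case: aU aU' => _ p0 [_ p0'].
have hep := emean_neq0 s1 p0 p0'.
have jp := emean_jump (pressure U) (pressure U') s1.
have jz := emean_jump (z_first alpha U) (z_first alpha U') s2.
rewrite hs1 in jp; rewrite hs2 in jz.
have hm : mean (z_first alpha U `^ (- gam / alpha))
               (z_first alpha U' `^ (- gam / alpha)) != 0.
  by rewrite gt_eqF// mean_gt0// powR_gt0.
have hf := divfK (mulf_neq0 hm hep)
  (mean (z_first alpha U * velocity U i 0) (z_first alpha U' * velocity U' i 0)).
rewrite -/(sy_mass i U U') in hf.
rewrite /dotv sum_state !subvE !entropy_varsE sy_flux_first sy_flux_last.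
under eq_bigr do rewrite sy_flux_mid subvE !entropy_vars_mid mulrDl -mulrA
  (mulrC (mean _ _) (_ - _)).
rewrite big_split/= -mulr_sumr sum_mean_jump.
rewrite sum_delta /sy_enthalpy /potential !dotvv.
exact: (sy_flux_tadmor_scalar (dotv (velocity U) (velocity U))
  (dotv (velocity U') (velocity U'))
  (\sum_j mean (velocity U j 0) (velocity U' j 0) ^+ 2)
  alpha_neq0 gam1_neq0 hP hP' jz jp hf).
Qed.

End Thermo.

(** * Differentials in pointwise form *)

Section DiffCalculus.
Context {R : realType} {V : normedModType R}.
Implicit Types (f g df dg : V -> R) (x : V).

Lemma is_diff_add f g df dg x : is_diff x f df -> is_diff x g dg ->
  is_diff x (fun y => f y + g y) (fun v => df v + dg v).
Proof. exact: is_diffD. Qed.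

Lemma is_diff_sub f g df dg x : is_diff x f df -> is_diff x g dg ->
  is_diff x (fun y => f y - g y) (fun v => df v - dg v).
Proof. exact: is_diffB. Qed.

Lemma is_diff_opp f df x : is_diff x f df ->
  is_diff x (fun y => - f y) (fun v => - df v).
Proof. exact: is_diffN. Qed.

Lemma is_diff_mul f g df dg x : is_diff x f df -> is_diff x g dg ->
  is_diff x (fun y => f y * g y) (fun v => f x * dg v + g x * df v).
Proof. exact: is_diffM. Qed.

Lemma is_diff_const (c : R) x : is_diff x (fun=> c) (fun=> 0).
Proof. exact: is_diff_cst. Qed.

Lemma is_diff_scale (c : R) f df x : is_diff x f df ->
  is_diff x (fun y => c * f y) (fun v => c * df v).
Proof. exact: is_diffZ. Qed.

Lemma is_diff_inv f df x : is_diff x f df -> f x != 0 ->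
  is_diff x (fun y => (f y)^-1) (fun v => - (f x ^- 2) * df v).
Proof.
move=> dfx f0; apply: DiffDef; first exact: differentiableV.
by rewrite diffV// diff_val.
Qed.

Lemma is_diff_sum n (f df : 'I_n -> V -> R) x :
  (forall i, is_diff x (f i) (df i)) ->
  is_diff x (fun y => \sum_i f i y) (fun v => \sum_i df i v).
Proof.
elim: n f df => [|n IH] f df dfx.
  have -> : (fun y => \sum_i f i y) = fun=> 0 by apply/funext => y; rewrite big_ord0.
  have -> : (fun y => \sum_i df i y) = fun=> 0 by apply/funext => y; rewrite big_ord0.
  exact: is_diff_const.
have -> : (fun y => \sum_i f i y) = fun y => f ord0 y + \sum_i f (lift ord0 i) y.
  by apply/funext => y; rewrite big_ord_recl.
have -> : (fun y => \sum_i df i y) = fun y => df ord0 y + \sum_i df (lift ord0 i) y.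
  by apply/funext => y; rewrite big_ord_recl.
exact: (is_diff_add (dfx ord0) (IH (fun i => f (lift ord0 i))
  (fun i => df (lift ord0 i)) (fun i => dfx (lift ord0 i)))).
Qed.

(** The quotient f(x)^a / f(x), rather than f(x)^(a-1), keeps a single power in
the formula, so that later identities are rational in it. *)
Lemma is_diff_powR (a : R) f df x : is_diff x f df -> 0 < f x ->
  is_diff x (fun y => f y `^ a) (fun v => a * (f x `^ a / f x) * df v).
Proof.
move=> dfx f0.
have dp := @is_derive1_powR R a (f x) f0.
have D : is_diff (f x) (@powR R ^~ a) (fun h => h *: (a * f x `^ (a - 1))).
  apply: DiffDef; first by apply/derivable1_diffP.
  rewrite diff1E; last by apply/derivable1_diffP.
  by rewrite derive1E derive_val.
apply: is_diff_eq (is_diff_comp dfx D) _.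
apply/funext => v; rewrite -[X in _ / X](powRr1 (ltW f0)) -powRB.
  exact: mulrC.
by apply/implyP => _; rewrite gt_eqF.
Qed.

End DiffCalculus.

Section DiffCoord.
Context {R : realType}.

Lemma is_diff_coord n (x : 'cV[R]_n) i :
  is_diff x (fun y => y i 0) (fun v => v i 0).
Proof.
pose f := (fun y => y i 0) : 'cV[R]_n -> R.
have f_lin : linear f by move=> a u v; rewrite /f !mxE.
pose fM := GRing.isLinear.Build _ _ _ _ _ f_lin.
pose fL : {linear _ -> _} := HB.pack f fM.
apply: DiffDef; first exact: differentiable_coord.
by rewrite (@diff_lin _ _ _ fL)//; exact: coord_continuous.
Qed.

End DiffCoord.

(** * The gradient of the entropy *)

Lemma dotv_delta {R : realType} n (x : 'cV[R]_n) j :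
  dotv x (delta_mx j 0) = x j 0.
Proof.
rewrite /dotv; under eq_bigr do rewrite mxE eqxx andbT mulr_natr mulrb.
by rewrite -big_mkcond big_pred1_eq.
Qed.

Section EntropyVariables.
Context {R : realType} {d : nat}.
Variable alpha : R.
Hypothesis halpha : 0 < alpha \/ alpha < - gam.
Implicit Types (U w v : 'cV[R]_d.+2).

Lemma is_diff_density U : is_diff U density (fun v => v ord0 0).
Proof. exact: is_diff_coord. Qed.

Lemma is_diff_velocity U (l : 'I_d) : density U != 0 ->
  is_diff U (fun y => velocity y l 0)
    (fun v => (v (mid l) 0 - velocity U l 0 * v ord0 0) / density U).
Proof.
move=> r0; have -> : (fun y => velocity y l 0) =
    (fun y : 'cV[R]_d.+2 => y (mid l) 0 * (density y)^-1).
  by apply/funext => y; rewrite mxE.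
apply: is_diff_eq (is_diff_mul (is_diff_coord _ _)
  (is_diff_inv (is_diff_density U) r0)) _.
by apply/funext => v; rewrite mxE; field.
Qed.

Lemma is_diff_speed2 U : density U != 0 ->
  is_diff U (fun y => dotv (velocity y) (velocity y))
    (fun v => 2 / density U * (\sum_l velocity U l 0 * v (mid l) 0
        - dotv (velocity U) (velocity U) * v ord0 0)).
Proof.
move=> r0.
apply: is_diff_eq (is_diff_sum (fun l =>
  is_diff_mul (is_diff_velocity l r0) (is_diff_velocity l r0))) _.
apply/funext => v; rewrite /dotv mulr_suml -sumrB mulr_sumr.
by apply: eq_bigr => l _; field.
Qed.

Lemma is_diff_pressure U : density U != 0 ->
  is_diff U pressure
    (fun v => (gam - 1) * (v ord_max 0 - \sum_l velocity U l 0 * v (mid l) 0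
        + 2^-1 * dotv (velocity U) (velocity U) * v ord0 0)).
Proof.
move=> r0.
apply: is_diff_eq (is_diff_scale (gam - 1) (is_diff_sub (is_diff_coord _ ord_max)
  (is_diff_mul (is_diff_scale 2^-1 (is_diff_density U)) (is_diff_speed2 r0)))) _.
by apply/funext => v /=; field.
Qed.

(** The coefficient beta / (alpha + gamma) = - 1 / (gamma - 1) in front of the
differential of the pressure cancels the factor gamma - 1 of the latter. *)
Lemma is_diff_entropy U : admissible U ->
  is_diff U (entropy alpha) (dotv (entropy_vars alpha U)).
Proof.
move=> aU; have := aU => -[r0 p0].
have rn0 : density U != 0 by rewrite gt_eqF.
have pn0 : pressure U != 0 by rewrite gt_eqF.
have q0 : 0 < pressure U * density U `^ (- gam) by rewrite mulr_gt0// powR_gt0.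
apply: is_diff_eq (is_diff_mul (is_diff_scale (harten_beta alpha) (is_diff_density U))
  (is_diff_powR (alpha + gam)^-1
    (is_diff_mul (is_diff_pressure rn0)
      (is_diff_powR (- gam) (is_diff_density U) r0)) q0)) _.
apply/funext => v /=; rewrite dotv_stack3.
under [in RHS]eq_bigr do rewrite mxE -mulrA.
rewrite -mulr_sumr /z_first -!/(harten_power alpha U) /harten_beta.
have rg0 : density U `^ (- gam) != 0 by rewrite gt_eqF// powR_gt0.
move: (alpha_gam_neq0 halpha) (@gam1_neq0 R) rg0.
move: (harten_power alpha U) (density U `^ _) (\sum_l _) (dotv _ _) => P rg K D.
move: gam => g ag g1 rg0.
by field; rewrite g1 ag rg0 rn0 pn0.
Qed.

(** The pressure recovered from z and the temperature q / r: eliminating the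
density from z = (r / q) (q r^(- gamma))^(1 / (alpha + gamma)) leaves a product
of powers, whose exponent in z is beta. *)
Lemma powR_state_pressure (z r q : R) : 0 < z -> 0 < r -> 0 < q ->
  z = r / q * (q * r `^ (- gam)) `^ (alpha + gam)^-1 ->
  q = z `^ harten_beta alpha * (q / r) `^ (- (alpha / (gam - 1))).
Proof.
move=> z0 r0 q0 ez; have Z := congr1 (@ln R) ez.
have rg0 : 0 < r `^ (- gam) by exact: powR_gt0.
have X0 : 0 < (q * r `^ (- gam)) `^ (alpha + gam)^-1.
  by apply: powR_gt0; exact: mulr_gt0.
have t0 : 0 < r / q by exact: divr_gt0.
have t0' : 0 < q / r by exact: divr_gt0.
apply: ln_inj; rewrite ?posrE//.
  by apply: mulr_gt0; exact: powR_gt0.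
rewrite lnM ?posrE ?powR_gt0// !ln_powR (ln_div q0 r0).
rewrite (lnM t0 X0) (ln_div r0 q0) ln_powR (lnM q0 rg0) ln_powR in Z.
rewrite Z /harten_beta; move: (alpha_gam_neq0 halpha) (@gam1_neq0 R).
by move: gam => g ag g1; field; rewrite g1 ag.
Qed.

Lemma entropy_varE U : admissible U -> entropy_var alpha U = entropy_vars alpha U.
Proof.
move=> aU; have D := is_diff_entropy aU.
by apply/colP => j; rewrite mxE /partial deriveE// diff_val dotv_delta.
Qed.

End EntropyVariables.

(** * The inverse of the entropy map *)

Section InverseMap.
Context {R : realType} {d : nat}.
Variable alpha : R.
Hypothesis halpha : 0 < alpha \/ alpha < - gam.
Implicit Types (U w v y : 'cV[R]_d.+2).

(** The primitive quantities of a state as functions of its entropy variables w.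
They are read off from the closed form of W: the last component gives z_1, the
middle ones V, the first one the temperature p / rho. *)
Definition ev_z w : R := - w ord_max 0.
Definition ev_velocity w : 'cV[R]_d := \col_l (w (mid l) 0 / ev_z w).
Definition ev_temp w : R :=
  - ((gam - 1) / alpha) *
    (w ord0 0 / ev_z w + 2^-1 * dotv (ev_velocity w) (ev_velocity w)).
Definition ev_pressure w : R :=
  ev_z w `^ harten_beta alpha * ev_temp w `^ (- (alpha / (gam - 1))).
Definition ev_density w : R := ev_pressure w / ev_temp w.
Definition ev_energy w : R :=
  (gam - 1)^-1 * ev_pressure w +
  2^-1 * (ev_density w * dotv (ev_velocity w) (ev_velocity w)).
Definition ev_state w : 'cV[R]_d.+2 :=
  stack3 (ev_density w) (ev_density w *: ev_velocity w) (ev_energy w).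

(** The image of the admissible states under the entropy map; it is open. *)
Definition ev_domain w : Prop := 0 < ev_z w /\ 0 < ev_temp w.

Lemma ev_pressure_gt0 w : ev_domain w -> 0 < ev_pressure w.
Proof. by move=> [z0 t0]; rewrite /ev_pressure mulr_gt0// powR_gt0. Qed.

Lemma ev_density_gt0 w : ev_domain w -> 0 < ev_density w.
Proof. by move=> Ow; apply: divr_gt0; [exact: ev_pressure_gt0|case: Ow]. Qed.

Lemma density_ev w : density (ev_state w) = ev_density w.
Proof. exact: stack3_first. Qed.

Lemma velocity_ev w : ev_domain w -> velocity (ev_state w) = ev_velocity w.
Proof.
move=> Ow; have r0 : ev_density w != 0 by rewrite gt_eqF// ev_density_gt0.
apply/colP => l; rewrite mxE density_ev stack3_mid mxE.
by rewrite mulrC mulKf.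
Qed.

Lemma energy_ev w : energy (ev_state w) = ev_energy w.
Proof. exact: stack3_last. Qed.

Lemma pressure_ev w : ev_domain w -> pressure (ev_state w) = ev_pressure w.
Proof.
move=> Ow; rewrite /pressure density_ev energy_ev velocity_ev// /ev_energy.
by rewrite -mulrA addrK mulVKf// gam1_neq0.
Qed.

Lemma admissible_ev w : ev_domain w -> admissible (ev_state w).
Proof.
move=> Ow; rewrite /admissible density_ev pressure_ev//.
by split; [exact: ev_density_gt0|exact: ev_pressure_gt0].
Qed.

Lemma temp_ev w : ev_domain w -> ev_pressure w / ev_density w = ev_temp w.
Proof.
move=> Ow; have p0 : ev_pressure w != 0 by rewrite gt_eqF// ev_pressure_gt0.
by rewrite /ev_density invfM invrK mulrA divff// mul1r.
Qed.

(** The converse elimination to [powR_state_pressure]. *)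
Lemma z_first_ev w : ev_domain w -> z_first alpha (ev_state w) = ev_z w.
Proof.
move=> Ow; have p0 := ev_pressure_gt0 Ow; case: (Ow) => z0 t0.
have aU := admissible_ev Ow.
apply: ln_inj; rewrite ?posrE//; first exact: z_first_gt0.
rewrite ln_z_first// density_ev pressure_ev// /ev_density (ln_div p0 t0).
have X0 : 0 < ev_z w `^ harten_beta alpha by exact: powR_gt0.
have Y0 : 0 < ev_temp w `^ (- (alpha / (gam - 1))) by exact: powR_gt0.
rewrite /ev_pressure (lnM X0 Y0) !ln_powR.
rewrite /harten_beta; move: (alpha_gam_neq0 halpha) (@gam1_neq0 R).
by move: gam => g ag g1; field; rewrite g1 ag.
Qed.

Lemma entropy_vars_ev w : ev_domain w -> entropy_vars alpha (ev_state w) = w.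
Proof.
move=> Ow; have z0 : ev_z w != 0 by case: Ow => z0 _; rewrite gt_eqF.
apply/colP; apply: state_index => [|l|]; rewrite entropy_varsE z_first_ev//.
- rewrite velocity_ev// pressure_ev// density_ev temp_ev// /ev_temp.
  move: (alpha_neq0 halpha) (@gam1_neq0 R).
  by move: gam => g a0 g1; field; rewrite a0 g1 z0.
- by rewrite velocity_ev// mxE mulrC divfK.
- by rewrite opprK.
Qed.

Section FromState.
Variable U : 'cV[R]_d.+2.
Hypothesis aU : admissible U.
Let w := entropy_vars alpha U.

Lemma ev_z_entropy : ev_z w = z_first alpha U.
Proof. by rewrite /ev_z entropy_vars_last opprK. Qed.

Lemma ev_velocity_entropy : ev_velocity w = velocity U.
Proof.
apply/colP => l; rewrite mxE entropy_vars_mid ev_z_entropy mulrC mulKf//.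
by rewrite gt_eqF// z_first_gt0.
Qed.

Lemma ev_temp_entropy : ev_temp w = pressure U / density U.
Proof.
have z0 : z_first alpha U != 0 by rewrite gt_eqF// z_first_gt0.
have r0 : density U != 0 by case: aU => r0 _; rewrite gt_eqF.
rewrite /ev_temp ev_velocity_entropy ev_z_entropy entropy_vars_first.
move: (alpha_neq0 halpha) (@gam1_neq0 R).
by move: (pressure U) gam => q g a0 g1; field; rewrite a0 g1 z0 r0.
Qed.

Lemma ev_domain_entropy : ev_domain w.
Proof.
case: (aU) => r0 p0; rewrite /ev_domain ev_temp_entropy ev_z_entropy.
by split; [exact: z_first_gt0|exact: divr_gt0].
Qed.

Lemma ev_pressure_entropy : ev_pressure w = pressure U.
Proof.
rewrite /ev_pressure ev_temp_entropy ev_z_entropy; apply/esym.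
case: (aU) => r0 p0.
by apply: powR_state_pressure => //; exact: z_first_gt0.
Qed.

Lemma ev_density_entropy : ev_density w = density U.
Proof.
case: (aU) => r0 p0.
rewrite /ev_density ev_pressure_entropy ev_temp_entropy.
by rewrite invfM invrK mulrA divff ?mul1r// gt_eqF.
Qed.

Lemma ev_state_entropy : ev_state w = U.
Proof.
have r0 : density U != 0 by case: aU => r0 _; rewrite gt_eqF.
apply/colP; apply: state_index => [|l|]; rewrite stack3E.
- exact: ev_density_entropy.
- rewrite mxE ev_density_entropy ev_velocity_entropy mxE.
  by rewrite mulrC divfK.
- rewrite /ev_energy ev_pressure_entropy ev_density_entropy ev_velocity_entropy.
  rewrite /pressure mulKf ?gam1_neq0// mulrA subrK//.
Qed.

End FromState.

Lemma cons_of_entropy_varE w : ev_domain w -> cons_of_entropy_var alpha w = ev_state w.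
Proof.
move=> Ow; rewrite /cons_of_entropy_var.
case: xgetP => [U _ [aU]|/(_ (ev_state w)) []].
  by rewrite entropy_varE// => <-; rewrite ev_state_entropy.
split; first exact: admissible_ev.
by rewrite entropy_varE ?entropy_vars_ev//; exact: admissible_ev.
Qed.

End InverseMap.

(** * The flux Jacobian in the entropy variables *)

Section FluxJacobian.
Context {R : realType} {d : nat}.
Variable alpha : R.
Hypothesis halpha : 0 < alpha \/ alpha < - gam.
Implicit Types (U w v y : 'cV[R]_d.+2) (i : 'I_d).

Section AtPoint.
Variable w : 'cV[R]_d.+2.
Hypothesis Ow : ev_domain alpha w.

Let z_neq0 : ev_z w != 0.
Proof. by case: Ow => z0 _; rewrite gt_eqF. Qed.

Let t_neq0 : ev_temp alpha w != 0.
Proof. by case: Ow => _ t0; rewrite gt_eqF. Qed.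

Lemma is_diff_ev_z : is_diff w ev_z (fun v => - v ord_max 0).
Proof. exact: is_diff_opp (is_diff_coord w ord_max). Qed.

Lemma is_diff_ev_velocity l : is_diff w (fun y => ev_velocity y l 0)
  (fun v => (v (mid l) 0 + ev_velocity w l 0 * v ord_max 0) / ev_z w).
Proof.
have -> : (fun y => ev_velocity y l 0) =
    (fun y : 'cV[R]_d.+2 => y (mid l) 0 * (ev_z y)^-1).
  by apply/funext => y; rewrite mxE.
apply: is_diff_eq (is_diff_mul (is_diff_coord w (mid l))
  (is_diff_inv is_diff_ev_z z_neq0)) _.
by apply/funext => v; rewrite mxE; field.
Qed.

Lemma is_diff_ev_speed2 :
  is_diff w (fun y => dotv (ev_velocity y) (ev_velocity y))
    (fun v => 2 / ev_z w * (\sum_l ev_velocity w l 0 * v (mid l) 0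
        + dotv (ev_velocity w) (ev_velocity w) * v ord_max 0)).
Proof.
apply: is_diff_eq (is_diff_sum (fun l =>
  is_diff_mul (is_diff_ev_velocity l) (is_diff_ev_velocity l))) _.
apply/funext => v; rewrite /dotv mulr_suml -big_split/= mulr_sumr.
by apply: eq_bigr => l _; field.
Qed.

Lemma is_diff_ev_temp :
  is_diff w (ev_temp alpha)
    (fun v => - ((gam - 1) / (alpha * ev_z w)) *
       (v ord0 0 + \sum_l ev_velocity w l 0 * v (mid l) 0 +
        (2^-1 * dotv (ev_velocity w) (ev_velocity w)
         - alpha / (gam - 1) * ev_temp alpha w) * v ord_max 0)).
Proof.
apply: is_diff_eq (is_diff_scale (- ((gam - 1) / alpha)) (is_diff_add
  (is_diff_mul (is_diff_coord w ord0) (is_diff_inv is_diff_ev_z z_neq0))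
  (is_diff_scale 2^-1 is_diff_ev_speed2))) _.
apply/funext => v; rewrite /ev_temp.
move: (alpha_neq0 halpha) (@gam1_neq0 R).
by move: gam => g a0 g1; field; rewrite a0 g1 z_neq0.
Qed.

(** The bracket is the increment of w paired with (1, V, h), h being the specific
total enthalpy; multiplied by rho V_i it is the convective part of F_i . dw. *)
Lemma is_diff_ev_pressure :
  is_diff w (ev_pressure alpha)
    (fun v => ev_density alpha w / ev_z w *
       (v ord0 0 + \sum_l ev_velocity w l 0 * v (mid l) 0 +
        (2^-1 * dotv (ev_velocity w) (ev_velocity w)
         + gam / (gam - 1) * ev_temp alpha w) * v ord_max 0)).
Proof.
case: (Ow) => z0 t0.
apply: is_diff_eq (is_diff_mul (is_diff_powR (harten_beta alpha) is_diff_ev_z z0)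
  (is_diff_powR (- (alpha / (gam - 1))) is_diff_ev_temp t0)) _.
apply/funext => v; rewrite /ev_density /ev_pressure.
move: (_ `^ _) (_ `^ _) => X Y; rewrite /harten_beta.
move: (alpha_neq0 halpha) (@gam1_neq0 R).
by move: gam => g a0 g1; field; rewrite a0 g1 z_neq0 t_neq0.
Qed.

End AtPoint.

Lemma euler_flux_first i U : euler_flux i U ord0 0 = density U * velocity U i 0.
Proof. exact: stack3_first. Qed.

Lemma euler_flux_mid i U (l : 'I_d) : euler_flux i U (mid l) 0 =
  density U * velocity U i 0 * velocity U l 0 + (i == l)%:R * pressure U.
Proof. by rewrite stack3_mid mxE. Qed.

Lemma euler_flux_last i U : euler_flux i U ord_max 0 =
  (energy U + pressure U) * velocity U i 0.
Proof. exact: stack3_last. Qed.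

Lemma energyE U : energy U =
  (gam - 1)^-1 * pressure U + 2^-1 * density U * dotv (velocity U) (velocity U).
Proof. by rewrite /pressure mulKf ?gam1_neq0// subrK. Qed.

Lemma dotv_euler_flux i U v : dotv (euler_flux i U) v =
  density U * velocity U i 0 *
    (v ord0 0 + \sum_l velocity U l 0 * v (mid l) 0)
  + pressure U * v (mid i) 0
  + (energy U + pressure U) * velocity U i 0 * v ord_max 0.
Proof.
rewrite /dotv sum_state euler_flux_first euler_flux_last.
under eq_bigr do rewrite euler_flux_mid mulrDl -mulrA.
by rewrite big_split/= -mulr_sumr sum_delta; ring.
Qed.

(** The pressure terms of W . F_i add up to - (alpha + 1) / (gamma - 1), which
is beta + 1, times psi_i; the kinetic terms cancel. *)
Lemma entropy_flux_contraction i U : admissible U ->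
  dotv (euler_flux i U) (entropy_vars alpha U) =
  (harten_beta alpha + 1) * potential alpha i U.
Proof.
move=> aU; have r0 : density U != 0 by case: aU => r0 _; rewrite gt_eqF.
rewrite dotv_euler_flux !entropy_varsE.
under eq_bigr do rewrite entropy_vars_mid mulrCA.
rewrite -mulr_sumr -/(dotv (velocity U) (velocity U)) energyE /potential.
rewrite /harten_beta; move: (@gam1_neq0 R).
by move: (pressure U) gam => q g g1; field; rewrite g1 r0.
Qed.

(** On the domain z_1 V_i is the middle component of w itself, so psi_i is a
coordinate times the pressure. *)
Definition ev_potential i y : R := y (mid i) 0 * ev_pressure alpha y.

Lemma potential_ev i y : ev_domain alpha y ->
  potential alpha i (ev_state alpha y) = ev_potential i y.
Proof.
move=> Oy; have z0 : ev_z y != 0 by case: Oy => z0 _; rewrite gt_eqF.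
rewrite /potential z_first_ev// velocity_ev// pressure_ev// mxE.
by rewrite [ev_z y * _]mulrC divfK.
Qed.

(** The gradient of psi_i in the entropy variables is the flux F_i. *)
Lemma is_diff_ev_potential i w : ev_domain alpha w ->
  is_diff w (ev_potential i) (dotv (euler_flux i (ev_state alpha w))).
Proof.
move=> Ow; have z0 : ev_z w != 0 by case: Ow => z0 _; rewrite gt_eqF.
have t0 : ev_temp alpha w != 0 by case: Ow => _ t0; rewrite gt_eqF.
apply: is_diff_eq (is_diff_mul (is_diff_coord w (mid i)) (is_diff_ev_pressure Ow)) _.
apply/funext => v; rewrite dotv_euler_flux density_ev energy_ev velocity_ev//.
rewrite pressure_ev// [in RHS]mxE /ev_energy /ev_density.
move: (\sum_l _) (dotv _ _) (ev_pressure _ _) (@gam1_neq0 R) => K D q.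
by move: gam => g g1; field; rewrite g1 z0 t0.
Qed.

(** The flux as an expression in w that is differentiable term by term; it
agrees with the Euler flux of the inverse image on the domain. *)
Definition ev_flux i y : 'cV[R]_d.+2 :=
  stack3 (ev_density alpha y * ev_velocity y i 0)
    (\col_l (ev_density alpha y * ev_velocity y i 0 * ev_velocity y l 0
              + (i == l)%:R * ev_pressure alpha y))
    ((ev_energy alpha y + ev_pressure alpha y) * ev_velocity y i 0).

Lemma euler_flux_ev i y : ev_domain alpha y ->
  euler_flux i (ev_state alpha y) = ev_flux i y.
Proof.
move=> Oy; rewrite /euler_flux velocity_ev// pressure_ev//.
by rewrite density_ev energy_ev.
Qed.

Lemma differentiable_ev_flux i w (a : 'I_d.+2) : ev_domain alpha w ->
  differentiable (fun y => ev_flux i y a 0) w.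
Proof.
move=> Ow; have t0 : ev_temp alpha w != 0 by case: Ow => _ t0; rewrite gt_eqF.
have Dp := is_diff_ev_pressure Ow.
have DV l := is_diff_ev_velocity Ow l.
have Dr := is_diff_mul Dp (is_diff_inv (is_diff_ev_temp Ow) t0).
have De := is_diff_add (is_diff_scale (gam - 1)^-1 Dp)
  (is_diff_scale 2^-1 (is_diff_mul Dr (is_diff_ev_speed2 Ow))).
move: a; apply: state_index => [|l|].
- under eq_fun do rewrite stack3_first.
  by have [] := is_diff_mul Dr (DV i).
- under eq_fun do rewrite stack3_mid mxE.
  by have [] := is_diff_add (is_diff_mul (is_diff_mul Dr (DV i)) (DV l))
    (is_diff_scale (i == l)%:R Dp).
- under eq_fun do rewrite stack3_last.
  by have [] := is_diff_mul (is_diff_add De Dp) (DV i).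
Qed.

Lemma near_ev_domain w : ev_domain alpha w -> \forall y \near w, ev_domain alpha y.
Proof.
move=> Ow; have [z0 t0] := Ow.
have cz : {for w, continuous (@ev_z R d)}.
  by apply: differentiable_continuous; have [] := is_diff_ev_z w.
have ct : {for w, continuous (@ev_temp R d alpha)}.
  by apply: differentiable_continuous; have [] := is_diff_ev_temp Ow.
near=> y; split; near: y; [exact: (cvgr_gt _ cz) | exact: (cvgr_gt _ ct)].
Unshelve. all: by end_near. Qed.

(** Differentiate w . F_i(w) = (beta + 1) psi_i(w) in the j-th direction: the left
side gives w . d_j F_i + F_ij and the right side (beta + 1) F_ij, because F_i is
the gradient of psi_i.  The identity holds on a neighbourhood of w since the
domain is open. *)
Lemma flux_jac_entropy i U j : admissible U ->
  \sum_a entropy_vars alpha U a 0 * flux_jac alpha i U a j =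
  harten_beta alpha * euler_flux i U j 0.
Proof.
move=> aU; set w := entropy_vars alpha U; set e : 'cV[R]_d.+2 := delta_mx j 0.
have Ow : ev_domain alpha w by exact: ev_domain_entropy.
have wU : ev_state alpha w = U by exact: ev_state_entropy.
pose G (a : 'I_d.+2) (y : 'cV[R]_d.+2) : R := ev_flux i y a 0.
have DG a : is_diff w (G a) ('d (G a) w).
  exact: differentiableP (differentiable_ev_flux i a Ow).
have jacE a : flux_jac alpha i U a j = 'd (G a) w e.
  rewrite /flux_jac mxE /partial entropy_varE// -/w -deriveE; last first.
    exact: differentiable_ev_flux.
  apply: near_eq_derive.
  near=> y; have Oy : ev_domain alpha y by near: y; exact: near_ev_domain.
  by rewrite /= cons_of_entropy_varE// euler_flux_ev.
have GU a : G a w = euler_flux i U a 0 by rewrite /G -euler_flux_ev// wU.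
have Dl := is_diff_sum (fun a => is_diff_mul (is_diff_coord w a) (DG a)).
have Dr := is_diff_scale (harten_beta alpha + 1) (is_diff_ev_potential i Ow).
have eq_near : \forall y \near w, \sum_a (y : 'cV[R]_d.+2) a 0 * G a y =
    (harten_beta alpha + 1) * ev_potential i y.
  near=> y; have Oy : ev_domain alpha y by near: y; exact: near_ev_domain.
  rewrite -potential_ev// -entropy_flux_contraction ?entropy_vars_ev//; last first.
    exact: admissible_ev.
  rewrite /dotv euler_flux_ev//.
  by apply: eq_bigr => a _; rewrite mulrC.
have := near_eq_derive e eq_near.
rewrite deriveE; last by have [] := Dl.
rewrite deriveE; last by have [] := Dr.
rewrite !diff_val big_split/= wU dotv_delta => sumE.
under eq_bigr do rewrite jacE.
have GE : \sum_a G a w * e a 0 = euler_flux i U j 0.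
  by under eq_bigr do rewrite GU; exact: dotv_delta.
by move: sumE; rewrite GE mulrDl mul1r => /addIr.
Unshelve. all: by end_near. Qed.

End FluxJacobian.

(** * Derivatives relative to a time interval *)

Section TimeDerivative.
Context {R : realType}.
Variables (J : interval R) (t : R).

(** The difference quotient of the composite is dg applied to that of f, plus the
first-order remainder of g divided by h; the latter tends to zero because the
difference quotients of f are eventually bounded. *)
Lemma has_deriv_in_comp (V : normedModType R) (f : R -> V) (g dg : V -> R) (l : V) :
  is_diff (f t) g dg -> has_deriv_in J f t l ->
  has_deriv_in J (g \o f) t (dg l).
Proof.
move=> [Dg dgE]; rewrite /has_deriv_in; set F := within _ _ => fl.
have FF : Filter F by exact: within_filter.
have subF : F `=>` 0^' by exact: cvg_within.
have N0 : \forall h \near (0 : R)^', h != 0 := nbhs_dnbhs_neq _.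
have F0 : \forall h \near F, h != 0 by exact: subF N0.
have Fh : h @[h --> F] --> (0 : R).
  exact: cvg_trans subF (@nbhs_dnbhs _ _).
have Fd : f (t + h) - f t @[h --> F] --> (0 : V).
  have : h *: (h^-1 *: (f (t + h) - f t)) @[h --> F] --> 0 *: l by exact: cvgZ.
  rewrite scale0r; apply: cvg_trans; apply: near_eq_cvg.
  by near=> h; rewrite scalerA divff ?scale1r//; near: h.
have cdg : dg (h^-1 *: (f (t + h) - f t)) @[h --> F] --> dg l.
  by rewrite -dgE; apply: (continuous_cvg _ _ fl); exact: diff_continuous.
have l0 : 0 < `|l| + 1 by rewrite ltr_wpDl.
apply/cvgrPdist_le => e e0.
have e1 : 0 < e / 2 / (`|l| + 1) by rewrite !divr_gt0.
(* the remainder of the first-order expansion of g, with a constant adapted to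
   the bound |l| + 1 for the difference quotients of f *)
have small : \forall k \near (0 : V),
    `|g (k + f t) - g (f t) - dg k| <= e / 2 / (`|l| + 1) * `|k|.
  have /eqaddoP /(_ _ e1) := diff_locally Dg; rewrite dgE; apply: filterS => k /=.
  by rewrite !fctE opprD addrA.
have bounded : \forall h \near F, `|h^-1 *: (f (t + h) - f t)| <= `|l| + 1.
  near=> h; rewrite -[X in `|X|](subrK l) (le_trans (ler_normD _ _))// addrC lerD2l.
  by rewrite distrC; near: h; exact: ((cvgrPdist_le _ _).1 fl 1 ltr01).
have e2 : 0 < e / 2 by rewrite divr_gt0.
near=> h.
have sm : `|g (f (t + h)) - g (f t) - dg (f (t + h) - f t)|
  <= e / 2 / (`|l| + 1) * `|f (t + h) - f t|.
  rewrite -[X in g X](subrK (f t)).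
  by near: h; exact: Fd small.
have dgZ a v : dg (a *: v) = a * dg v by rewrite -dgE linearZ.
rewrite distrC (_ : _ - dg l = h^-1 * (g (f (t + h)) - g (f t) - dg (f (t + h) - f t))
  + (dg (h^-1 *: (f (t + h) - f t)) - dg l)); last first.
  by rewrite dgZ mulrBr addrA subrK.
rewrite (splitr e) (le_trans (ler_normD _ _))// lerD//; last first.
  by rewrite distrC; near: h; exact: ((cvgrPdist_le _ _).1 cdg _ e2).
rewrite normrM (le_trans (ler_wpM2l _ sm))// mulrCA -normrZ.
have bh : `|h^-1 *: (f (t + h) - f t)| <= `|l| + 1 by near: h.
by rewrite (le_trans (ler_wpM2l (ltW e1) bh))// divfK// gt_eqF.
Unshelve. all: by end_near. Qed.

Lemma has_deriv_in_col n (f : R -> 'cV[R]_n) (l : 'cV[R]_n) :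
  (forall j, has_deriv_in J (fun s => f s j 0) t (l j 0)) ->
  has_deriv_in J f t l.
Proof.
rewrite /has_deriv_in; set F := within _ _ => fl.
have FF : Filter F by exact: within_filter.
apply/cvgrPdist_le => e e0; near=> h.
rewrite /Num.Def.normr/= mx_normrE (bigmax_le _ (ltW e0))//= => -[i j] _.
rewrite !mxE/= (ord1 j).
move: i {j}; near: h; apply: filter_forall => i.
exact: ((cvgrPdist_le _ _).1 (fl i)).
Unshelve. all: by end_near. Qed.

End TimeDerivative.

(** * Nodal form of the discrete operators *)

Section Dotv.
Context {R : realType} {n : nat}.
Implicit Types x y : 'cV[R]_n.

Lemma dotvC x y : dotv x y = dotv y x.
Proof. by apply: eq_bigr => i _; rewrite mulrC. Qed.

Lemma dotvDr x y z : dotv x (y + z) = dotv x y + dotv x z.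
Proof. by rewrite /dotv -big_split; apply: eq_bigr => i _; rewrite mxE mulrDr. Qed.

Lemma dotvZr x a y : dotv x (a *: y) = a * dotv x y.
Proof. by rewrite /dotv mulr_sumr; apply: eq_bigr => i _; rewrite mxE mulrCA. Qed.

Lemma dotvNr x y : dotv x (- y) = - dotv x y.
Proof. by rewrite -scaleN1r dotvZr mulN1r. Qed.

Lemma dotvBr x y z : dotv x (y - z) = dotv x y - dotv x z.
Proof. by rewrite dotvDr dotvNr. Qed.

Lemma dotv_sumr x (I : Type) (r : seq I) (P : pred I) (F : I -> 'cV[R]_n) :
  dotv x (\sum_(i <- r | P i) F i) = \sum_(i <- r | P i) dotv x (F i).
Proof.
elim/big_rec2: _ => [|i a b _ <-]; last by rewrite dotvDr.
by rewrite /dotv big1// => i _; rewrite mxE mulr0.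
Qed.

End Dotv.

Section Nodal.
Context {R : realType} {d : nat}.
Local Notation nc := d.+2.

Lemma sum_tens (V : zmodType) n (F : 'I_(n * nc) -> V) :
  \sum_b F b = \sum_m \sum_c F (mxtens_index (m, c)).
Proof.
rewrite pair_bigA/= (reindex (@mxtens_index n nc))/=.
  by apply: eq_bigr => -[].
by exists (@mxtens_unindex n nc) => x _; [exact: mxtens_indexK|exact: mxtens_unindexK].
Qed.

Section OneElement.
Variable n : nat.
Implicit Types (u v x y : 'cV[R]_(n * nc)) (m : 'I_n).

Lemma nodalD x y m : nodal (x + y) m = nodal x m + nodal y m.
Proof. by apply/colP => c; rewrite !mxE. Qed.

Lemma nodalZ a x m : nodal (a *: x) m = a *: nodal x m.
Proof. by apply/colP => c; rewrite !mxE. Qed.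

Lemma nodalN x m : nodal (- x) m = - nodal x m.
Proof. by apply/colP => c; rewrite !mxE. Qed.

Lemma nodalB x y m : nodal (x - y) m = nodal x m - nodal y m.
Proof. by rewrite nodalD nodalN. Qed.

Lemma nodal_sum (I : Type) (r : seq I) (P : pred I) (F : I -> 'cV[R]_(n * nc)) m :
  nodal (\sum_(i <- r | P i) F i) m = \sum_(i <- r | P i) nodal (F i) m.
Proof. by apply/colP => c; rewrite mxE !summxE; apply: eq_bigr => i _; rewrite mxE. Qed.

Lemma nodal_inj x y : (forall m, nodal x m = nodal y m) -> x = y.
Proof.
move=> xy; apply/colP => b; rewrite -[b]mxtens_unindexK.
case: (mxtens_unindex b) => m c.
by move/colP: (xy m) => /(_ c); rewrite !mxE.
Qed.

Lemma nodal_stack (f : 'cV[R]_nc -> 'cV[R]_nc) u m :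
  nodal (stack f u) m = f (nodal u m).
Proof. by apply/colP => c; rewrite !mxE mxtens_indexK. Qed.

Lemma nodal_block_diag (A : 'cV[R]_nc -> 'M[R]_nc) u x m :
  nodal (block_diag A u *m x) m = A (nodal u m) *m nodal x m.
Proof.
apply/colP => c; rewrite !mxE sum_tens (bigD1 m)//= [X in _ + X]big1 ?addr0.
  by apply: eq_bigr => c' _; rewrite !mxE !mxtens_indexK eqxx.
move=> l /negPf lm; rewrite big1// => c' _.
by rewrite !mxE !mxtens_indexK eq_sym lm mul0r.
Qed.

End OneElement.

Lemma onesE n j : ones n j 0 = 1 :> R.
Proof. by rewrite mxE. Qed.

Lemma nodal_overbar n p (A : 'M[R]_(n, p)) (x : 'cV[R]_(p * nc)) (m : 'I_n) :
  nodal (overbar A *m x) m = \sum_l A m l *: nodal x l.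
Proof.
apply/colP => c; rewrite !mxE summxE sum_tens; apply: eq_bigr => l _.
rewrite (bigD1 c)//= big1 ?addr0 => [|c' /negPf cc'].
  by rewrite tensmxE !mxE eqxx mulr1.
by rewrite tensmxE !mxE eq_sym cc' mulr0 mul0r.
Qed.

(** The blocks of the flux matrix and those of a Kronecker product with the
identity are diagonal, so components do not mix. *)
Lemma hadamard_flux_mxE alpha i n (A : 'M[R]_n) (u v : 'cV[R]_(n * nc)) m l c c' :
  hadamard (overbar A) (flux_mx alpha i u v)
    (mxtens_index (m, c)) (mxtens_index (l, c')) =
  (2 * (A m l * sy_flux alpha i (nodal u m) (nodal v l) c 0)) *+ (c' == c).
Proof.
have -> : hadamard (overbar A) (flux_mx alpha i u v)
    (mxtens_index (m, c)) (mxtens_index (l, c')) =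
  overbar A (mxtens_index (m, c)) (mxtens_index (l, c')) *
  flux_mx alpha i u v (mxtens_index (m, c)) (mxtens_index (l, c')).
  by rewrite mxE.
rewrite tensmxE mxE [flux_mx _ _ _ _ _ _]mxE !mxtens_indexK.
move: (sy_flux _ _ _ _) => s.
have -> : (2 *: diag_mx s^T) c c' = 2 * (s c 0 *+ (c' == c)) by rewrite !mxE eq_sym.
case: (eqVneq c' c) => _; first by rewrite mulr1 mulr1n mulrCA.
by rewrite mulr0 mul0r mulr0n.
Qed.

Lemma nodal_hadamard alpha i n (A : 'M[R]_n) (u v : 'cV[R]_(n * nc)) m :
  nodal (hadamard (overbar A) (flux_mx alpha i u v) *m ones _) m =
  2 *: \sum_l A m l *: sy_flux alpha i (nodal u m) (nodal v l).
Proof.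
apply/colP => c; rewrite 2!mxE [RHS]mxE summxE sum_tens mulr_sumr.
apply: eq_bigr => l _.
under eq_bigr do rewrite hadamard_flux_mxE onesE mulr1 mulrb.
by rewrite -big_mkcond big_pred1_eq [in RHS]mxE.
Qed.

Lemma diag_mulE n p (H : 'M[R]_n) (A : 'M[R]_(n, p)) m l : is_diag_mx H ->
  (H *m A) m l = H m m * A m l.
Proof.
move=> /is_diag_mxP Hd; rewrite mxE (bigD1 m)//= big1 ?addr0// => l' l'm.
by rewrite Hd ?mul0r// eq_sym.
Qed.

Lemma unitmx_diag n (H : 'M[R]_n) : is_diag_mx H -> (forall m, 0 < H m m) ->
  H \in unitmx.
Proof.
move=> /diag_mxP [D ->] H0; rewrite unitmxE det_diag unitfE.
apply/prodf_neq0 => m _.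
by have := H0 m; rewrite mxE eqxx mulr1n => /gt_eqF ->.
Qed.

Lemma nodal_overbar_inv n (H : 'M[R]_n) (x : 'cV[R]_(n * nc)) m :
  is_diag_mx H -> (forall m, 0 < H m m) ->
  H m m *: nodal (invmx (overbar H) *m x) m = nodal x m.
Proof.
move=> Hd H0; have Hu := unitmx_diag Hd H0.
have oU : overbar (d := d) H \in unitmx.
  apply: (@tensmx_unit R n nc H 1%:M); rewrite ?unitmx1//.
  by rewrite -lt0n (leq_ltn_trans (leq0n m) (ltn_ord m)).
rewrite -[in RHS](mulKVmx oU x) nodal_overbar (bigD1 m)//= big1 ?addr0// => l lm.
by move/is_diag_mxP: Hd => ->; rewrite ?scale0r// eq_sym.
Qed.

End Nodal.

(** * Summation by parts and the entropy balance of an element *)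

Section SummationByParts.
Context {R : realType} {d : nat} {M : mesh R d} {np nf : nat}.
Variable B : sbp M np nf.
Variable p : nat.
Hypothesis hB : sbp_axioms B p.
Implicit Types (i : 'I_d) (k v : elem M) (g : face M) (f : 'I_nf).

Definition facet_weight i k g f : R :=
  matB B g f f * normal k g (node B k (facet_node B k g f)) i 0.

Lemma couplingE i g k v m n : coupling B i g k v m n =
  \sum_f facet_weight i k g f *
    ((m == facet_node B k g f)%:R * (n == facet_node B v g f)%:R).
Proof.
have /diag_mxP [D BE] := matB_diag hB g.
rewrite /coupling /facet_weight BE mul_mx_diag mul_mx_diag mxE.
by apply: eq_bigr => f _; rewrite !mxE eqxx mulr1n; ring.
Qed.

(** A coupling matrix pairs each facet node of k with the matching node of v and
has no other nonzero entry. *)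
Lemma coupling_sum (V : lmodType R) i g k v (Phi : 'I_np -> 'I_np -> V) :
  \sum_m \sum_n coupling B i g k v m n *: Phi m n =
  \sum_f facet_weight i k g f *:
    Phi (facet_node B k g f) (facet_node B v g f).
Proof.
transitivity (\sum_f \sum_m \sum_n (facet_weight i k g f *
    ((m == facet_node B k g f)%:R * (n == facet_node B v g f)%:R)) *: Phi m n).
  rewrite [RHS]exchange_big/=; apply: eq_bigr => m _.
  rewrite [RHS]exchange_big/=; apply: eq_bigr => n _.
  by rewrite couplingE scaler_suml.
apply: eq_bigr => f _; rewrite (bigD1 (facet_node B k g f))//=.
rewrite [X in _ + X]big1 ?addr0 => [|m /negPf ->]; last first.
  by rewrite big1// => n _; rewrite mul0r mulr0 scale0r.
rewrite (bigD1 (facet_node B v g f))//= big1 ?addr0 => [|n /negPf ->].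
  by rewrite !eqxx !mulr1.
by rewrite !mulr0 scale0r.
Qed.

(** Consequently E only sees the diagonal of a two-index quantity: replacing Phi
m n by Phi n m, Phi m m or Phi n n does not change the sum. *)
Lemma matE_sum (V : lmodType R) i k (Phi : 'I_np -> 'I_np -> V) :
  \sum_m \sum_n matE B i k m n *: Phi m n =
  \sum_(g in faces k) \sum_f facet_weight i k g f *:
    Phi (facet_node B k g f) (facet_node B k g f).
Proof.
under [RHS]eq_bigr do rewrite -coupling_sum.
rewrite [RHS]exchange_big/=; apply: eq_bigr => m _.
rewrite [RHS]exchange_big/=; apply: eq_bigr => n _.
by rewrite /matE summxE scaler_suml.
Qed.

Lemma matH_matD i k : matH B k *m matD B i k = matQ B i k.
Proof.
rewrite /matD mulKVmx//; apply: unitmx_diag => [|m].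
  exact: matH_diag hB k.
exact: matH_gt0 hB k m.
Qed.

Lemma matH_matDE i k m n : matH B k m m * matD B i k m n = matQ B i k m n.
Proof.
rewrite -matH_matD (diag_mulE (matD B i k))//; exact: matH_diag hB k.
Qed.

Lemma matQE i k m n : matQ B i k m n = matS B i k m n + 2^-1 * matE B i k m n.
Proof. by rewrite !mxE. Qed.

Lemma matS_skewE i k m n : matS B i k m n = - matS B i k n m.
Proof. by have /matrixP/(_ n m) := matS_skew hB i k; rewrite !mxE. Qed.

Lemma matD_const i k : matD B i k *m ones np = 0.
Proof.
have := matD_exact hB i k (P := mpoly.mpolyC d 1).
have -> : nodal_poly B k (mpoly.mpolyC d 1) = ones np.
  by apply/colP => m; rewrite !mxE /polyval mpoly.mevalC.
move=> ->; last first.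
  by rewrite /poly_deg_le mpoly.msuppC oner_eq0 /= mpoly.mdeg0.
rewrite mpoly.mderivC; apply/colP => m.
by rewrite !mxE /polyval mpoly.meval0.
Qed.

Lemma matQ_const i k m : \sum_n matQ B i k m n = 0.
Proof.
have Q1 : matQ B i k *m ones np = 0.
  by rewrite -matH_matD -mulmxA matD_const mulmx0.
transitivity ((matQ B i k *m ones np) m 0); last by rewrite Q1 mxE.
by rewrite mxE; apply: eq_bigr => n _; rewrite onesE mulr1.
Qed.

Lemma matS_const i k m : \sum_n matS B i k m n = - 2^-1 * \sum_n matE B i k m n.
Proof.
have := matQ_const i k m; under eq_bigr do rewrite matQE.
by rewrite big_split/= -mulr_sumr => /addr0_eq SE; rewrite mulNr -SE opprK.
Qed.

Section ElementBalance.
Variable alpha : R.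
Hypothesis halpha : 0 < alpha \/ alpha < - gam.
Implicit Types (u du : elem M -> 'cV[R]_(np * d.+2)).

(** The contribution of the facet g to the entropy rate of k under either scheme:
flux of the potential through g minus the numerical flux tested against W. *)
Definition facet_production u k g : R :=
  let v := neighbour k g in
  \sum_i \sum_f facet_weight i k g f *
    (potential alpha i (nodal (u k) (facet_node B k g f))
     - dotv (entropy_vars alpha (nodal (u k) (facet_node B k g f)))
         (sy_flux alpha i (nodal (u k) (facet_node B k g f))
            (nodal (u v) (facet_node B v g f)))).

Definition entropy_rate u du k : R :=
  \sum_m matH B k m m *
    dotv (entropy_vars alpha (nodal (u k) m)) (nodal (du k) m).

Lemma nodal_interface_flux u k g i m :
  nodal (interface_flux alpha B u k g i) m =
  2 *: \sum_n coupling B i g k (neighbour k g) m n *: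
    sy_flux alpha i (nodal (u k) m) (nodal (u (neighbour k g)) n).
Proof. exact: nodal_hadamard. Qed.

Lemma scaleCA (V : lmodType R) (a b : R) (x : V) : a *: (b *: x) = b *: (a *: x).
Proof. by rewrite !scalerA mulrC. Qed.

(** The interface terms of either scheme at the node m, multiplied by H_mm. *)
Definition nodal_interface u k m : 'cV[R]_d.+2 :=
  \sum_(g in faces k) \sum_i \sum_n coupling B i g k (neighbour k g) m n *:
       sy_flux alpha i (nodal (u k) m) (nodal (u (neighbour k g)) n).

Lemma nodal_interface_sum u k m :
  2^-1 *: nodal (\sum_(g in faces k) \sum_i interface_flux alpha B u k g i) m =
  nodal_interface u k m.
Proof.
rewrite nodal_sum scaler_sumr; apply: eq_bigr => g _.
rewrite nodal_sum scaler_sumr; apply: eq_bigr => i _.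
by rewrite nodal_interface_flux scalerA mulVf ?scale1r// pnatr_eq0.
Qed.

(** The volume terms with D and with E combine to 2 S, since 2 Q = 2 S + E. *)
Lemma scheme_HF_nodal u du k m : scheme_HF alpha B u du k ->
  matH B k m m *: nodal (du k) m =
  - (2 *: \sum_i \sum_n matS B i k m n *:
       sy_flux alpha i (nodal (u k) m) (nodal (u k) n))
  - nodal_interface u k m.
Proof.
rewrite /scheme_HF; move/(congr1 (fun x => matH B k m m *: nodal x m)).
rewrite nodalD nodalB !nodalZ scalerDr scalerBr !(scaleCA (matH B k m m)).
rewrite !nodal_overbar_inv; try exact: (matH_diag hB); try exact: (matH_gt0 hB k).
rewrite nodal_interface_sum !nodal_sum => /(canRL (addrK _)) ->.
rewrite addrAC; congr (_ - _); rewrite !scaler_sumr -sumrB -sumrN.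
apply: eq_bigr => i _.
rewrite !nodal_hadamard (scalerA 2^-1) mulVf ?pnatr_eq0// scale1r.
rewrite scaleCA !scaler_sumr -sumrB -sumrN; apply: eq_bigr => n _.
have HD := matH_matDE i k m n; rewrite matQE in HD.
rewrite !scalerA -[RHS]scaleNr -scalerBl; congr (_ *: _).
by rewrite -mulrA HD; field.
Qed.

Lemma scheme_ES_nodal u du k m : scheme_ES alpha B u du k ->
  matH B k m m *: nodal (du k) m =
  \sum_i \sum_n matE B i k m n *: euler_flux i (nodal (u k) n)
  - (harten_beta alpha / (harten_beta alpha + 1)) *:
      \sum_i \sum_n matQ B i k m n *: euler_flux i (nodal (u k) n)
  - (harten_beta alpha + 1)^-1 *:
      \sum_i flux_jac alpha i (nodal (u k) m) *m
         \sum_n matQ B i k m n *: entropy_var alpha (nodal (u k) n)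
  - nodal_interface u k m.
Proof.
rewrite /scheme_ES; move/(congr1 (fun x => matH B k m m *: nodal x m)).
rewrite !nodalD nodalN !nodalZ !scalerDr scalerN !(scaleCA (matH B k m m)).
rewrite !nodal_overbar_inv; try exact: (matH_diag hB); try exact: (matH_gt0 hB k).
rewrite nodal_interface_sum !nodal_sum.
move=> /(canRL (addrK _)) /(canRL (addrK _)) ->.
have volE i (x : 'cV[R]_(np * d.+2)) :
    matH B k m m *: nodal (overbar (matD B i k) *m x) m =
    \sum_n matQ B i k m n *: nodal x n.
  rewrite nodal_overbar scaler_sumr; apply: eq_bigr => n _.
  by rewrite scalerA matH_matDE.
have -> : \sum_i nodal (overbar (matE B i k) *m stack (euler_flux i) (u k)) m =
    \sum_i \sum_n matE B i k m n *: euler_flux i (nodal (u k) n).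
  apply: eq_bigr => i _; rewrite nodal_overbar.
  by apply: eq_bigr => n _; rewrite nodal_stack.
have -> : matH B k m m *: (\sum_i nodal (overbar (matD B i k) *m
      stack (euler_flux i) (u k)) m) =
    \sum_i \sum_n matQ B i k m n *: euler_flux i (nodal (u k) n).
  rewrite scaler_sumr; apply: eq_bigr => i _; rewrite volE.
  by apply: eq_bigr => n _; rewrite nodal_stack.
have -> : matH B k m m *: (\sum_i nodal (block_diag (flux_jac alpha i) (u k) *m
      (overbar (matD B i k) *m stack (entropy_var alpha) (u k))) m) =
    \sum_i flux_jac alpha i (nodal (u k) m) *m
         \sum_n matQ B i k m n *: entropy_var alpha (nodal (u k) n).
  rewrite scaler_sumr; apply: eq_bigr => i _.
  rewrite nodal_block_diag scalemxAr volE; congr (_ *m _).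
  by apply: eq_bigr => n _; rewrite nodal_stack.
by rewrite [LHS]addrAC [X in X - _]addrAC [LHS]addrAC.
Qed.

Lemma interface_rate u k :
  \sum_m dotv (entropy_vars alpha (nodal (u k) m)) (nodal_interface u k m) =
  \sum_(g in faces k) \sum_i \sum_f facet_weight i k g f *
    dotv (entropy_vars alpha (nodal (u k) (facet_node B k g f)))
      (sy_flux alpha i (nodal (u k) (facet_node B k g f))
        (nodal (u (neighbour k g)) (facet_node B (neighbour k g) g f))).
Proof.
under eq_bigr do rewrite dotv_sumr.
rewrite exchange_big/=; apply: eq_bigr => g _.
under eq_bigr do rewrite dotv_sumr.
rewrite exchange_big/=; apply: eq_bigr => i _.
under eq_bigr do rewrite dotv_sumr.
under eq_bigr do under eq_bigr do rewrite dotvZr.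
exact: (coupling_sum (V := R^o) i g k (neighbour k g) (fun m n =>
  dotv (entropy_vars alpha (nodal (u k) m))
   (sy_flux alpha i (nodal (u k) m) (nodal (u (neighbour k g)) n)))).
Qed.

Lemma facet_productionE u k :
  \sum_(g in faces k) facet_production u k g =
  \sum_i \sum_m \sum_n matE B i k m n * potential alpha i (nodal (u k) n)
  - \sum_m dotv (entropy_vars alpha (nodal (u k) m)) (nodal_interface u k m).
Proof.
rewrite interface_rate.
under [X in _ = X - _]eq_bigr => i _ do
  rewrite (matE_sum (V := R^o) i k (fun m n => potential alpha i (nodal (u k) n))).
rewrite [X in _ = X - _]exchange_big/= -sumrB; apply: eq_bigr => g _.
rewrite -sumrB; apply: eq_bigr => i _.
by rewrite -sumrB; apply: eq_bigr => f _; rewrite -mulrBr.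
Qed.

(** The volume term is the sum of 2 S_mn W_m . F*(m, n).  Skew-symmetry of S and
symmetry of F* replace 2 W_m . F*(m, n) by (W_m - W_n) . F*(m, n), which is
psi_m - psi_n by Tadmor's condition; the row sums of S then yield the facet
values of psi. *)
Lemma entropy_rate_HF u du k : (forall m, admissible (nodal (u k) m)) ->
  scheme_HF alpha B u du k ->
  entropy_rate u du k = \sum_(g in faces k) facet_production u k g.
Proof.
move=> adm HF; rewrite facet_productionE.
pose W m := entropy_vars alpha (nodal (u k) m).
pose psi i m := potential alpha i (nodal (u k) m).
pose F i m n := sy_flux alpha i (nodal (u k) m) (nodal (u k) n).
have -> : entropy_rate u du k =
    - (\sum_i \sum_m \sum_n matS B i k m n * (2 * dotv (W m) (F i m n))) -
    \sum_m dotv (W m) (nodal_interface u k m).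
  rewrite [X in - X - _]exchange_big/= -sumrN -sumrB; apply: eq_bigr => m _.
  rewrite -dotvZr (scheme_HF_nodal m HF) dotvBr dotvNr dotvZr dotv_sumr mulr_sumr.
  congr (- _ - _); apply: eq_bigr => i _; rewrite dotv_sumr mulr_sumr.
  by apply: eq_bigr => n _; rewrite dotvZr mulrCA.
congr (_ - _); rewrite -sumrN; apply: eq_bigr => i _.
have -> : \sum_m \sum_n matS B i k m n * (2 * dotv (W m) (F i m n)) =
    \sum_m \sum_n matS B i k m n * (psi i m - psi i n).
  transitivity (\sum_m \sum_n matS B i k m n * (dotv (W m) (F i m n)) -
                \sum_m \sum_n matS B i k m n * (dotv (W n) (F i m n))).
    rewrite [X in _ = _ - X]exchange_big/= -sumrB; apply: eq_bigr => m _.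
    rewrite -sumrB; apply: eq_bigr => n _.
    by rewrite /F sy_fluxC (matS_skewE i k n m); ring.
  rewrite -sumrB; apply: eq_bigr => m _; rewrite -sumrB; apply: eq_bigr => n _.
  rewrite -mulrBr; congr (_ * _).
  by rewrite 2!(dotvC _ (F i m n)) -dotvBr sy_flux_tadmor.
have skew : \sum_m \sum_n matS B i k m n * psi i n =
    - \sum_m \sum_n matS B i k m n * psi i m.
  rewrite exchange_big/= -sumrN; apply: eq_bigr => m _.
  by rewrite -sumrN; apply: eq_bigr => n _; rewrite matS_skewE mulNr.
have rowS : \sum_m \sum_n matS B i k m n * psi i m =
    - 2^-1 * \sum_m \sum_n matE B i k m n * psi i m.
  rewrite mulr_sumr; apply: eq_bigr => m _.
  rewrite -!mulr_suml matS_const.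
  exact: esym (mulrA _ _ _).
have Ediag : \sum_m \sum_n matE B i k m n * psi i m =
             \sum_m \sum_n matE B i k m n * psi i n.
  rewrite (matE_sum (V := R^o) i k (fun m n => psi i m)).
  by rewrite (matE_sum (V := R^o) i k (fun m n => psi i n)).
under eq_bigr do under eq_bigr do rewrite mulrBr.
under eq_bigr do rewrite sumrB.
rewrite sumrB skew opprK rowS Ediag.
by field.
Qed.

Lemma dotv_flux_jac i (U y : 'cV[R]_d.+2) : admissible U ->
  dotv (entropy_vars alpha U) (flux_jac alpha i U *m y) =
  harten_beta alpha * dotv (euler_flux i U) y.
Proof.
move=> aU; rewrite /dotv.
transitivity (\sum_j
  (\sum_a entropy_vars alpha U a 0 * flux_jac alpha i U a j) * y j 0).
  under [RHS]eq_bigr do rewrite mulr_suml.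
  rewrite [RHS]exchange_big/=; apply: eq_bigr => a _.
  by rewrite [X in _ * X]mxE mulr_sumr; apply: eq_bigr => j _; rewrite mulrA.
rewrite mulr_sumr; apply: eq_bigr => j _.
by rewrite flux_jac_entropy// mulrA.
Qed.

(** In the proof X, Y and Z pair W with F through E, through Q, and through the
transpose of Q.  The Jacobian term equals beta Z, and Y + Z = X, so the volume
and boundary terms leave X - beta / (beta + 1) X = X / (beta + 1). *)
Lemma entropy_rate_ES u du k : (forall m, admissible (nodal (u k) m)) ->
  scheme_ES alpha B u du k ->
  entropy_rate u du k = \sum_(g in faces k) facet_production u k g.
Proof.
move=> adm ES; rewrite facet_productionE.
pose W m := entropy_vars alpha (nodal (u k) m).
pose F i m := euler_flux i (nodal (u k) m).
set b := harten_beta alpha.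
have b1 : b + 1 != 0 := beta1_neq0 halpha.
pose X i := \sum_m \sum_n matE B i k m n * dotv (W m) (F i n).
pose Y i := \sum_m \sum_n matQ B i k m n * dotv (W m) (F i n).
pose Z i := \sum_m \sum_n matQ B i k m n * dotv (F i m) (W n).
have -> : entropy_rate u du k =
    \sum_i (X i - b / (b + 1) * Y i - (b + 1)^-1 * (b * Z i)) -
    \sum_m dotv (W m) (nodal_interface u k m).
  rewrite !sumrB -!mulr_sumr.
  rewrite [X in X - _ - _ - _]exchange_big/=.
  rewrite [X in _ - _ * X - _ - _]exchange_big/=.
  rewrite [X in _ - _ - _ * (_ * X) - _]exchange_big/=.
  rewrite !mulr_sumr -!sumrB; apply: eq_bigr => m _.
  rewrite -dotvZr (scheme_ES_nodal m ES) !dotvBr !dotvZr !dotv_sumr.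
  congr (_ - _ * _ - _ - _).
  - by apply: eq_bigr => i _; rewrite dotv_sumr; apply: eq_bigr => n _; rewrite dotvZr.
  - by apply: eq_bigr => i _; rewrite dotv_sumr; apply: eq_bigr => n _; rewrite dotvZr.
  - congr (_ * _); rewrite mulr_sumr; apply: eq_bigr => i _.
    rewrite dotv_flux_jac//; congr (_ * _).
    rewrite dotv_sumr; apply: eq_bigr => n _.
    by rewrite dotvZr entropy_varE.
congr (_ - _); apply: eq_bigr => i _.
have Ediag : \sum_m \sum_n matE B i k n m * dotv (W m) (F i n) = X i.
  rewrite exchange_big/= /X.
  rewrite (matE_sum (V := R^o) i k (fun n m => dotv (W m) (F i n))).
  by rewrite (matE_sum (V := R^o) i k (fun m n => dotv (W m) (F i n))).
have YZ : Y i + Z i = X i.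
  (* X is written as half the sum of its expressions through E and through the
     transpose of E *)
  rewrite /Z exchange_big/= -[RHS]mul1r -(mulVf (_ : 2 != 0)) ?pnatr_eq0//.
  rewrite -mulrA mulr2n mulrDl mul1r -[in X in _ = _ * (_ + X)]Ediag.
  rewrite -!big_split/= mulr_sumr; apply: eq_bigr => m _.
  rewrite -!big_split/= mulr_sumr; apply: eq_bigr => n _.
  rewrite !matQE (matS_skewE i k n m) (dotvC (F i n)).
  by ring.
have XE : X i = (b + 1) *
    \sum_m \sum_n matE B i k m n * potential alpha i (nodal (u k) n).
  rewrite /X (matE_sum (V := R^o) i k (fun m n => dotv (W m) (F i n))).
  rewrite (matE_sum (V := R^o) i k (fun m n => potential alpha i (nodal (u k) n))).
  rewrite mulr_sumr; apply: eq_bigr => g _; rewrite mulr_sumr; apply: eq_bigr => f _.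
  by rewrite dotvC entropy_flux_contraction//; exact: mulrCA.
transitivity ((b + 1)^-1 * X i); last by rewrite XE mulKf.
by rewrite -YZ; field.
Qed.

End ElementBalance.

End SummationByParts.

(** * Cancellation across the facets *)

Section Mesh.
Context {R : realType} {d : nat} (M : mesh R d) (p : nat).
Hypothesis hM : mesh_axioms M p.
Implicit Types (k v : elem M) (g : face M).

Lemma neighbourP k g : g \in faces k ->
  [/\ neighbour k g != k, g \in faces (neighbour k g) &
      forall v, g \in faces v -> v != k -> v = neighbour k g].
Proof.
move=> gk; have := face_shared hM g.
rewrite (cardD1 k) inE gk add1n => -[] /mem_card1 [v vP].
have vE w : (w != k) && (g \in faces w) = (w == v).
  by have := vP w; rewrite !inE.
have -> : neighbour k g = v.
  rewrite /neighbour; case: pickP => [w|/(_ v)] /=; rewrite vE ?eqxx//.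
  by move/eqP.
have /andP[vk gv] : (v != k) && (g \in faces v) by rewrite vE.
by split=> // w gw wk; apply/eqP; rewrite -vE wk.
Qed.

Lemma neighbourK k g : g \in faces k -> neighbour (neighbour k g) g = k.
Proof.
move=> gk; have [vk gv _] := neighbourP gk; have [_ _ uniq_v] := neighbourP gv.
by apply/esym/uniq_v => //; rewrite eq_sym.
Qed.

(** For each face, crossing it is an involution on its two elements; it maps the
sum of T over these elements to its opposite. *)
Lemma sum_faces_antisym (T : elem M -> face M -> R) :
  (forall k g, g \in faces k -> T k g + T (neighbour k g) g = 0) ->
  \sum_k \sum_(g in faces k) T k g = 0.
Proof.
move=> anti; rewrite (exchange_big_dep xpredT)//=; apply: big1 => g _.
set S := \sum_(k | _) _; suff : S + S = 0.
  by move/eqP; rewrite -mulr2n mulrn_eq0 => /eqP.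
rewrite [X in X + _](reindex_onto (fun k => neighbour k g)
  (fun k => neighbour k g))/=; last first.
  by move=> k gk; exact: neighbourK.
rewrite (eq_bigl (fun k => g \in faces k)); last first.
  move=> k; apply/andP/idP => [[gv /eqP vk]|gk].
    by have [_ + _] := neighbourP gv; rewrite vk.
  by have [_ gv _] := neighbourP gk; rewrite neighbourK.
by rewrite -big_split big1//= => k gk; rewrite addrC anti.
Qed.

End Mesh.

Section Scheme.
Context {R : realType} {d p np nf : nat} (alpha : R).
Context {M : mesh R d} (B : sbp M np nf).
Hypothesis halpha : 0 < alpha \/ alpha < - gam.
Hypotheses (hM : mesh_axioms M p) (hB : sbp_axioms B p).
Implicit Types (k v : elem M) (g : face M) (u du : elem M -> 'cV[R]_(np * d.+2)).

Lemma facet_weight_neighbour i k g f : g \in faces k ->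
  facet_weight B i (neighbour k g) g f = - facet_weight B i k g f.
Proof.
move=> gk; rewrite /facet_weight (facet_node_match hB)// (normal_opposite hM)//.
  by rewrite mxE mulrN.
exact: (facet_node_in hB).
Qed.

(** The normals of the two elements are opposite, so the sum is a difference of
traces, and Tadmor's condition makes it vanish node by node. *)
Lemma facet_production_antisym u k g : g \in faces k ->
  (forall k m, admissible (nodal (u k) m)) ->
  facet_production B alpha u k g + facet_production B alpha u (neighbour k g) g = 0.
Proof.
move=> gk adm; rewrite /facet_production (neighbourK hM gk).
rewrite -big_split big1//= => i _; rewrite -big_split big1//= => f _.
rewrite facet_weight_neighbour//.
set U := nodal (u k) _; set U' := nodal (u (neighbour k g)) _.
rewrite mulNr -mulrBr (sy_fluxC alpha i U' U) 2!(dotvC _ (sy_flux _ _ _ _)).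
have := sy_flux_tadmor halpha i (adm k (facet_node B k g f))
  (adm (neighbour k g) (facet_node B (neighbour k g) g f)).
rewrite -/U -/U' dotvBr => psiE.
have -> : forall a b x y : R, a - x - (b - y) = (a - b) - (x - y) by move=> *; ring.
by rewrite psiE subrr mulr0.
Qed.

Lemma has_deriv_in_nodal J t (u : R -> 'cV[R]_(np * d.+2)) l m :
  has_deriv_in J u t l ->
  has_deriv_in J (fun s => nodal (u s) m) t (nodal l m).
Proof.
move=> ul; apply: has_deriv_in_col => c.
have nodalE (x : 'cV[R]_(np * d.+2)) : nodal x m c 0 = x (mxtens_index (m, c)) 0.
  by rewrite mxE.
rewrite nodalE (_ : (fun s => _) = (fun y => y (mxtens_index (m, c)) 0) \o u).
  exact: has_deriv_in_comp (is_diff_coord (u t) (mxtens_index (m, c))) ul.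
by apply/funext => s; rewrite nodalE.
Qed.

Lemma hybrid_entropy_conservation (HF : {set elem M}) J
    (u du : R -> elem M -> 'cV[R]_(np * d.+2)) :
  hybrid_solution alpha B HF J u du -> entropy_conservation alpha B J u.
Proof.
move=> sol t tJ.
have adm k m : admissible (nodal (u t k) m) by have [] := sol t tJ k.
exists (fun k => \col_m dotv (entropy_vars alpha (nodal (u t k) m)) (nodal (du t k) m)).
split=> [k|].
  have [_ der _] := sol t tJ k.
  apply: has_deriv_in_col => m.
  rewrite mxE (_ : (fun s => _) = entropy alpha \o (fun s => nodal (u s k) m)).
    exact: (has_deriv_in_comp (f := fun s => nodal (u s k) m)
      (is_diff_entropy halpha (adm k m)) (has_deriv_in_nodal (m := m) der)).
  by apply/funext => s; rewrite mxE.
pose T k g := facet_production B alpha (u t) k g.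
have rate k : (ones np)^T *m matH B k *m
    (\col_m dotv (entropy_vars alpha (nodal (u t k) m)) (nodal (du t k) m)) =
    (\sum_(g in faces k) T k g)%:M.
  have -> : \sum_(g in faces k) T k g = entropy_rate B alpha (u t) (du t) k.
    have [_ _] := sol t tJ k; case: ifP => _ sch.
      by rewrite (entropy_rate_HF hB halpha (adm k) sch).
    by rewrite (entropy_rate_ES hB halpha (adm k) sch).
  apply/rowP => j; rewrite !ord1 -mulmxA mxE [RHS]mxE eqxx mulr1n.
  apply: eq_bigr => m _.
  by rewrite (diag_mulE _ m 0 (matH_diag hB k)) !mxE mul1r.
under eq_bigr do rewrite rate.
rewrite -raddf_sum (sum_faces_antisym hM) ?raddf0// => k g gk.
exact: facet_production_antisym.
Qed.

Lemma nodal_sum_mx (y : 'cV[R]_(np * d.+2)) (j : 'I_1) :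
  nodal ((sum_mx (d := d) np)^T *m y) j = \sum_m nodal y m.
Proof.
pose A : 'M[R]_(1, np) := (ones np)^T.
have AE : (sum_mx (R := R) (d := d) np)^T = overbar (d := d) A.
  apply: (etrans (trmx_tens _ _)).
  by congr (_ *t _); exact: trmx1.
rewrite AE (nodal_overbar A); apply: eq_bigr => m _.
by rewrite !mxE scale1r.
Qed.

Lemma nodal_interface_term u k g (j : 'I_1) :
  nodal (interface_term alpha B u k g) j =
  - \sum_i \sum_f facet_weight B i k g f *:
      sy_flux alpha i (nodal (u k) (facet_node B k g f))
        (nodal (u (neighbour k g)) (facet_node B (neighbour k g) g f)).
Proof.
rewrite nodalZ nodal_sum scaleNr scaler_sumr; congr (- _).
apply: eq_bigr => i _; rewrite nodal_sum_mx.
under eq_bigr do rewrite nodal_interface_flux.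
rewrite -scaler_sumr scalerA mulVf ?pnatr_eq0// scale1r.
exact: (coupling_sum hB i g k (neighbour k g) (fun m n =>
  sy_flux alpha i (nodal (u k) m) (nodal (u (neighbour k g)) n))).
Qed.

Lemma interface_term_cancel u k g : g \in faces k ->
  interface_term alpha B u k g + interface_term alpha B u (neighbour k g) g = 0.
Proof.
move=> gk; apply: nodal_inj => j; rewrite nodalD.
apply: (etrans (congr2 +%R (nodal_interface_term u k g j)
  (nodal_interface_term u (neighbour k g) g j))).
rewrite (neighbourK hM gk) -opprD -big_split big1 ?oppr0; last first.
  move=> i _; rewrite -big_split big1//= => f _.
  by rewrite facet_weight_neighbour// sy_fluxC scaleNr subrr.
by apply/colP => c; rewrite !mxE.
Qed.

(** Summed over the nodes, the volume term of (HF) contracts the skew-symmetric S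
with the symmetric two-point flux. *)
Lemma scheme_HF_conservative u du k : scheme_HF alpha B u du k ->
  locally_conservative alpha B u du k.
Proof.
move=> HF; split=> [|g gk]; last exact: interface_term_cancel.
apply: nodal_inj => j; rewrite -mulmxA nodal_sum_mx nodal_sum.
have -> : \sum_m nodal (overbar (matH B k) *m du k) m =
    - (2 *: \sum_i \sum_m \sum_n matS B i k m n *:
         sy_flux alpha i (nodal (u k) m) (nodal (u k) n))
    - \sum_m nodal_interface B alpha u k m.
  rewrite [X in 2 *: X]exchange_big/= scaler_sumr -sumrN -sumrB.
  apply: eq_bigr => m _; rewrite -(scheme_HF_nodal hB m HF) nodal_overbar.
  rewrite (bigD1 m)//= big1 ?addr0// => n nm.
  by have /is_diag_mxP -> := matH_diag hB k; rewrite ?scale0r// eq_sym.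
have -> : \sum_i \sum_m \sum_n matS B i k m n *:
    sy_flux alpha i (nodal (u k) m) (nodal (u k) n) = 0.
  rewrite big1// => i _.
  set S := \sum_m _; suff SN : S = - S.
    have : 2 *: S = 0 by rewrite scaler_nat mulr2n {1}SN addNr.
    by move/eqP; rewrite scaler_eq0 pnatr_eq0 => /eqP.
  rewrite {1}/S exchange_big/= -sumrN; apply: eq_bigr => m _.
  rewrite -sumrN; apply: eq_bigr => n _.
  by rewrite (matS_skewE hB i k n m) sy_fluxC scaleNr.
rewrite scaler0 oppr0 add0r exchange_big/= -sumrN; apply: eq_bigr => g _.
rewrite nodal_interface_term exchange_big/=; congr (- _); apply: eq_bigr => i _.
exact: (coupling_sum hB i g k (neighbour k g) (fun m n =>
  sy_flux alpha i (nodal (u k) m) (nodal (u (neighbour k g)) n))).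
Qed.

End Scheme.

Theorem theorem4 (R : realType) (d p np nf : nat) (alpha : R)
    (M : mesh R d) (B : sbp M np nf)
    (hd : (1 <= d <= 3)%N) (halpha : 0 < alpha \/ alpha < - gam)
    (hM : mesh_axioms M p) (hB : sbp_axioms B p) :
  (* (a) *)
  (forall (HF : {set elem M}) (J : interval R)
      (u du : R -> elem M -> 'cV[R]_(np * d.+2)),
    hybrid_solution alpha B HF J u du -> entropy_conservation alpha B J u) /\
  (* (b) *)
  (forall (HF : {set elem M}) (J : interval R)
      (u du : R -> elem M -> 'cV[R]_(np * d.+2)),
    hybrid_solution alpha B HF J u du ->
    forall t k, t \in J -> k \in HF ->
    locally_conservative alpha B (u t) (du t) k) /\
  (* (c) *)
  (forall (N : nat) (tau : nat -> R) (HF : nat -> {set elem M})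
      (u : R -> elem M -> 'cV[R]_(np * d.+2))
      (du : nat -> R -> elem M -> 'cV[R]_(np * d.+2)),
    (forall n, (n < N)%N -> tau n < tau n.+1) ->
    (forall n, (n < N)%N ->
      hybrid_solution alpha B (HF n) `[tau n, tau n.+1] u (du n)) ->
    forall n, (n < N)%N ->
      entropy_conservation alpha B `[tau n, tau n.+1] u).
Proof.
split; last split.
- exact: hybrid_entropy_conservation halpha hM hB.
- move=> HF J u du sol t k tJ kHF; apply: (scheme_HF_conservative hM hB).
  by have [_ _] := sol t tJ k; rewrite kHF.
- move=> N tau HF u du _ sol n nN.
  exact: hybrid_entropy_conservation halpha hM hB _ _ _ _ (sol n nN).
Qed.
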